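(* For a bounded rational polyhedron $P=\{\boldsymbol x\in\mathbb R^n:A\boldsymbol x\le\boldsymbol b\}$ with $m$ inequalities ($A\in\mathbb Q^{m\times n}$, $\boldsymbol b\in\mathbb Q^m$), one can construct a symmetric displacement cover $\mathcal C$ of $P\cap\mathbb Z^n$ with at most $$(m+1)^n\,n^{O(n)}\,(1+\langle A,\boldsymbol b\rangle_{\max})^{2n}$$ pairs, in time $$(m+1)^{O(n)}\,n^{O(n)}\,(1+\langle A,\boldsymbol b\rangle_{\max})^{O(n)}\,(1+\langle A,\boldsymbol b\rangle)^{O(1)}.$$ Each pair $(C,D_C)\in\mathcal C$ has description length at most $p(n)(1+\langle A,\boldsymbol b\rangle_{\max})$ for an absolute polynomial $p$. Each $D_C$ is defined in a rational subspace by at most $n$ two-sided linear inequalities whose normals have trivial common kernel in that subspace. The final polynomial degree (the exponent $O(1)$ of $1+\langle A,\boldsymbol b\rangle$) in the construction time is absolute.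
   Context: Symmetric displacement cover. Let $P\subseteq\mathbb R^n$ be a bounded rational polyhedron. A symmetric displacement cover of $P\cap\mathbb Z^n$ is a finite family $\mathcal C$ of pairs $(C,D_C)$ such that: (1) each cell $C\subseteq P$ is specified by rational linear equalities and inequalities, possibly strict, and the cells cover $P\cap\mathbb Z^n$; (2) each $D_C$ is a rational polytope containing $\boldsymbol 0$ and symmetric about $\boldsymbol 0$, with $C-C\subseteq D_C$, $C+D_C\subseteq P$ and $C-D_C\subseteq P$ (inclusions of sets of real points). Cells may overlap and need not cover all of $P$. For a rational number $r=p/q$ in lowest terms with $q>0$, its binary encoding length is $\langle r\rangle=1+\lceil\log_2(1+|p|)\rceil+\lceil\log_2(1+q)\rceil$. For a list of matrices, vectors or scalars, $\langle\cdot\rangle$ is the total binary encoding length, including dimensions, and $\langle\cdot\rangle_{\max}$ is the maximum encoding length of an individual scalar entry ($1$ for an empty collection). Throughout $n\ge1$. Algorithms use exact rational arithmetic and time counts bit operations; hidden constants are absolute. *)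

(* Defs.v *)
From HB Require Import structures.
From mathcomp Require Import all_boot all_order all_algebra.
From mathcomp Require Import all_classical all_reals.
From mathcomp Require Import topology normedtype.

Set Implicit Arguments.
Unset Strict Implicit.
Unset Printing Implicit Defensive.

Import Order.TTheory GRing.Theory Num.Theory.
Import numFieldNormedType.Exports.

Local Open Scope classical_set_scope.
Local Open Scope ring_scope.

(** * Encoding lengths *)

(* up_log 2 k is the ceiling of log_2 k. *)
Definition enclen (r : rat) : nat :=
  (1 + up_log 2 (1 + `|numq r|) + up_log 2 (1 + `|denq r|))%N.

Definition mx_enclen (m n : nat) (A : 'M[rat]_(m, n)) : nat :=
  (enclen m%:R + enclen n%:R + \sum_(i < m) \sum_(j < n) enclen (A i j))%N.

Definition mx_enclen_max (m n : nat) (A : 'M[rat]_(m, n)) : nat :=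
  \max_(i < m) \max_(j < n) enclen (A i j).

(* The total length and the maximal scalar length of the pair (A, b). Every
   scalar has length at least 2, so the maxn 1 only matters for an empty
   collection. *)
Definition enclen_sys (m n : nat) (A : 'M[rat]_(m, n)) (b : 'cV[rat]_m) : nat :=
  (mx_enclen A + mx_enclen b)%N.

Definition enclen_sys_max (m n : nat) (A : 'M[rat]_(m, n)) (b : 'cV[rat]_m) :
    nat :=
  maxn 1 (maxn (mx_enclen_max A) (mx_enclen_max b)).

(** * Rational constraints and the sets of real points they define *)

Inductive crel := CEq | CLe | CLt.

Definition crel_code (k : crel) : nat :=
  match k with CEq => 0 | CLe => 1 | CLt => 2 end.

Definition crel_decode (i : nat) : crel :=
  match i with 0%N => CEq | 1%N => CLe | _ => CLt end.

Lemma crel_codeK : cancel crel_code crel_decode.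
Proof. by case. Qed.

HB.instance Definition _ := Equality.copy crel (can_type crel_codeK).

(* (a, k, beta) stands for  a x = beta,  a x <= beta  or  a x < beta. *)
Definition constr (n : nat) : Type := ('rV[rat]_n * crel * rat)%type.

Section RealPoints.
Variables (R : realType) (n : nat).
Implicit Types (w : 'rV[rat]_n) (x y : 'cV[R]_n) (P : set 'cV[R]_n).

Definition dotr w x : R := \sum_(j < n) ratr (w 0 j) * x j 0.

Definition constr_holds (c : constr n) x : Prop :=
  let: (w, k, beta) := c in
  match k with
  | CEq => dotr w x = ratr beta
  | CLe => dotr w x <= ratr beta
  | CLt => dotr w x < ratr beta
  end.

Definition solset (s : seq (constr n)) : set 'cV[R]_n :=
  [set x | forall c, c \in s -> constr_holds c x].

Definition polyhedron (m : nat) (A : 'M[rat]_(m, n)) (b : 'cV[rat]_m) :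
    set 'cV[R]_n :=
  [set x | forall i, (map_mx ratr A *m x) i 0 <= ratr (b i 0)].

Definition rational_polytope (s : seq (constr n)) : Prop :=
  (forall c, c \in s -> c.1.2 != CLt) /\ bounded_set (solset s).

Definition symmetric_displacement_cover
    P (cov : seq (seq (constr n) * seq (constr n))) : Prop :=
  (forall z : 'cV[int]_n, P (map_mx intr z) ->
     exists2 CD, CD \in cov & solset CD.1 (map_mx intr z)) /\
  forall CD, CD \in cov ->
    let C := solset CD.1 in
    let D := solset CD.2 in
    [/\ C `<=` P,
        [/\ rational_polytope CD.2, D 0 & forall x, D x -> D (- x)],
        forall x y, C x -> C y -> D (x - y),
        forall x d, C x -> D d -> P (x + d)
      & forall x d, C x -> D d -> P (x - d)].

(* Inside the subspace  e x = 0 (e in E),  the two-sided inequalities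
   l <= w x <= u  for ((w, l), u) in W. *)
Definition two_sided_system
    (E : seq 'rV[rat]_n) (W : seq ('rV[rat]_n * rat * rat)) :
    seq (constr n) :=
  [seq (e, CEq, 0) | e <- E] ++
  flatten [seq [:: (- q.1.1, CLe, - q.1.2); (q.1.1, CLe, q.2)] | q <- W].

Definition trivial_common_kernel
    (E : seq 'rV[rat]_n) (W : seq ('rV[rat]_n * rat * rat)) : Prop :=
  forall x, (forall e, e \in E -> dotr e x = 0) ->
            (forall q, q \in W -> dotr q.1.1 x = 0) -> x = 0.

End RealPoints.

Arguments polyhedron R {n m} A b.
Arguments trivial_common_kernel R {n} E W.

Definition constr_enclen (n : nat) (c : constr n) : nat :=
  (mx_enclen c.1.1 + enclen (crel_code c.1.2)%:R + enclen c.2)%N.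

Definition descr_enclen (n : nat) (s : seq (constr n)) : nat :=
  (enclen (size s)%:R + \sum_(c <- s) constr_enclen c)%N.

Definition pair_enclen (n : nat) (CD : seq (constr n) * seq (constr n)) : nat :=
  (descr_enclen CD.1 + descr_enclen CD.2)%N.

(** * Algorithms with exact rational arithmetic, timed in bit operations

   An algorithm is a program in a first-order call-by-value language with
   recursion; programs are finite syntax, hence independent of the input. Data
   are binary trees with rational leaves.

   The time charges each instruction an upper bound, up to a constant factor,
   for its bit operations: reading a variable or a constant copies it and costs
   its whole bit size, an arithmetic operation costs the square of the length
   of its operands (schoolbook multiplication, Euclidean algorithm for lowest
   terms), and every other step costs 1. As no data are shared, the size of
   every value that is built is at most the time spent. *)

Inductive val := VNum of rat | VPair of val & val.

Fixpoint vsize (v : val) : nat :=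
  match v with
  | VNum r => enclen r
  | VPair v1 v2 => (1 + vsize v1 + vsize v2)%N
  end.

Inductive unop := OOpp | OInv | OFloor | ONum | ODen.

Inductive binop := OAdd | OMul | OLe.

Definition un_sem (o : unop) (r : rat) : rat :=
  match o with
  | OOpp => - r
  | OInv => r^-1
  | OFloor => (Num.floor r)%:~R
  | ONum => (numq r)%:~R
  | ODen => (denq r)%:~R
  end.

Definition bin_sem (o : binop) (r s : rat) : rat :=
  match o with
  | OAdd => r + s
  | OMul => r * s
  | OLe => if r <= s then 1 else 0
  end.

(* EVar is a de Bruijn index; ECall f e runs the f-th definition of the
   program in the environment that only contains the value of e. *)
Inductive expr :=
  | EVar of nat
  | EConst of rat
  | EPair of expr & expr
  | EFst of expr
  | ESnd of expr
  | EIsPair of expr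
  | EUn of unop & expr
  | EBin of binop & expr & expr
  | EIf of expr & expr & expr
  | ELet of expr & expr
  | ECall of nat & expr.

Record program := Program { defs : seq expr; main : expr }.

(* eval ds env e v t: in the environment env, the expression e terminates with
   value v in time t. *)
Inductive eval (ds : seq expr) : seq val -> expr -> val -> nat -> Prop :=
  | ev_var env i : (i < size env)%N ->
      eval ds env (EVar i) (nth (VNum 0) env i) (vsize (nth (VNum 0) env i))
  | ev_const env r : eval ds env (EConst r) (VNum r) (enclen r)
  | ev_pair env e1 e2 v1 v2 t1 t2 :
      eval ds env e1 v1 t1 -> eval ds env e2 v2 t2 ->
      eval ds env (EPair e1 e2) (VPair v1 v2) (t1 + t2).+1
  | ev_fst env e v1 v2 t :
      eval ds env e (VPair v1 v2) t -> eval ds env (EFst e) v1 t.+1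
  | ev_snd env e v1 v2 t :
      eval ds env e (VPair v1 v2) t -> eval ds env (ESnd e) v2 t.+1
  | ev_ispair env e v t :
      eval ds env e v t ->
      eval ds env (EIsPair e)
        (VNum (if v is VPair _ _ then 1 else 0)) (t + 2).+1
  | ev_un env o e r t :
      eval ds env e (VNum r) t ->
      eval ds env (EUn o e) (VNum (un_sem o r)) (t + enclen r ^ 2)
  | ev_bin env o e1 e2 r1 r2 t1 t2 :
      eval ds env e1 (VNum r1) t1 -> eval ds env e2 (VNum r2) t2 ->
      eval ds env (EBin o e1 e2) (VNum (bin_sem o r1 r2))
        (t1 + t2 + (enclen r1 + enclen r2) ^ 2)
  | ev_if_true env e e1 e2 r v t t1 :
      eval ds env e (VNum r) t -> r != 0 -> eval ds env e1 v t1 ->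
      eval ds env (EIf e e1 e2) v (t + t1).+1
  | ev_if_false env e e1 e2 v t t2 :
      eval ds env e (VNum 0) t -> eval ds env e2 v t2 ->
      eval ds env (EIf e e1 e2) v (t + t2).+1
  | ev_let env e1 e2 v1 v2 t1 t2 :
      eval ds env e1 v1 t1 -> eval ds (v1 :: env) e2 v2 t2 ->
      eval ds env (ELet e1 e2) v2 (t1 + t2).+1
  | ev_call env f e v w t1 t2 :
      (f < size ds)%N ->
      eval ds env e v t1 -> eval ds [:: v] (nth (EConst 0) ds f) w t2 ->
      eval ds env (ECall f e) w (t1 + t2).+1.

Definition computes_in (p : program) (input output : val) (t : nat) : Prop :=
  eval (defs p) [:: input] (main p) output t.

(** * Inputs and outputs as data *)

Definition enc_seq (s : seq val) : val := foldr VPair (VNum 0) s.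

Definition enc_row (n : nat) (w : 'rV[rat]_n) : val :=
  enc_seq [seq VNum (w 0 j) | j <- enum 'I_n].

Definition enc_input (m n : nat) (A : 'M[rat]_(m, n)) (b : 'cV[rat]_m) : val :=
  VPair (VPair (VNum m%:R) (VNum n%:R))
    (VPair (enc_seq [seq enc_row (row i A) | i <- enum 'I_m]) (enc_row b^T)).

Definition enc_constr (n : nat) (c : constr n) : val :=
  VPair (enc_row c.1.1) (VPair (VNum (crel_code c.1.2)%:R) (VNum c.2)).

Definition enc_descr (n : nat) (s : seq (constr n)) : val :=
  enc_seq (map (@enc_constr n) s).

Definition enc_cover (n : nat) (cov : seq (seq (constr n) * seq (constr n))) :
    val :=
  enc_seq [seq VPair (enc_descr CD.1) (enc_descr CD.2) | CD <- cov].

(* Main.v *)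
(* Let v be an integer point of P with slacks s_i = b_i - a_i v. Among the
   families f of n independent rows of A choose one that has the largest number
   of slacks 0 and then the largest value of |det A_f| / prod s_(f j), the
   product being over the nonzero slacks. Writing a_i = sum_j c_ij a_(f j), an
   exchange argument gives |c_ij| s_(f j) <= s_i for all i and j. Enclose the
   slack of each chosen row in one of the 2n equal parts of a dyadic interval, or
   in {0}: its width is at most s_(f j) / 2n. The resulting box C of values of
   the rows a_(f j) and the box D of differences of these values satisfy
   C - C <= D and, since the rows dominate all the slacks, C + D <= P and
   C - D <= P. The number of dyadic intervals is logarithmic in the largest
   scaled slack, which is attained at a vertex and bounded by Cramer's rule.

   The algorithm enumerates all families of n rows with such intervals and keeps
   those that define boxes with C + D <= P and C - D <= P, which is a linear
   condition on the c_ij. Its running time is polynomial in the number of these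
   families, the number n ^ n of words in the expansion of a determinant and
   the input size. *)

(* The 2n comes from the dominance test. Replacing v by the center of C costs half a width of each
   chosen row, and C + D reaches 3/2 widths beyond the center, so a_i grows by at most the sum over
   j of 2 |c_ij| w_j, where w_j is the width for row f j. With w_j <= s_(f j) / 2n each term is at
   most s_i / n, and the n terms fit into the slack s_i. Scaling a row by the product of its
   denominators makes the slack of an integer point an integer; a nonzero one is then at least 1,
   and the dyadic intervals start there. The running time is exponential in n, yet its degree in the
   input size must be absolute. Functions are therefore shown to be polynomial relative to a measure
   that may exceed the size of the encoding, and the measure of an instance includes the budget
   (m+1)^n n^n (L+1)^n (S+1), with L the maximal and S the total length. Enumerations of that order
   then count as polynomial, and a fixed power of the budget has the required form. *)
Require Import Defs.
From HB Require Import structures.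
From mathcomp Require Import all_boot all_order all_algebra.
From mathcomp Require Import all_classical all_reals.
From mathcomp Require Import topology normedtype.
From mathcomp Require Import perm zify ring lra.

Set Implicit Arguments.
Unset Strict Implicit.
Unset Printing Implicit Defensive.

Import Order.TTheory GRing.Theory Num.Theory.
Import numFieldNormedType.Exports.
Local Open Scope ring_scope.

(** * Linking programs *)

(* The definitions of a program are renumbered when they are put after k other
   ones. *)
Fixpoint shift (k : nat) (e : expr) : expr :=
  match e with
  | EVar i => EVar i
  | EConst r => EConst r
  | EPair e1 e2 => EPair (shift k e1) (shift k e2)
  | EFst e1 => EFst (shift k e1)
  | ESnd e1 => ESnd (shift k e1)
  | EIsPair e1 => EIsPair (shift k e1)
  | EUn o e1 => EUn o (shift k e1)
  | EBin o e1 e2 => EBin o (shift k e1) (shift k e2)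
  | EIf e1 e2 e3 => EIf (shift k e1) (shift k e2) (shift k e3)
  | ELet e1 e2 => ELet (shift k e1) (shift k e2)
  | ECall f e1 => ECall (k + f) (shift k e1)
  end.

Lemma eval_shift ds0 ds env e v t : Defs.eval ds env e v t ->
  Defs.eval (ds0 ++ map (shift (size ds0)) ds) env (shift (size ds0) e) v t.
Proof.
elim=> {env e v t} /=; try by [econstructor; eauto].
move=> env f e v w t1 t2 fds _ IH1 _ IH2.
apply: (ev_call (v := v)) => //.
  by rewrite size_cat size_map ltn_add2l.
by rewrite nth_cat ltnNge leq_addr /= addKn (nth_map (EConst 0)).
Qed.

Lemma eval_app ds ds' env e v t : Defs.eval ds env e v t ->
  Defs.eval (ds ++ ds') env e v t.
Proof.
elim=> {env e v t} /=; try by [econstructor; eauto].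
move=> env f e v w t1 t2 fds _ IH1 _ IH2.
apply: (ev_call (v := v)) => //.
  by rewrite size_cat ltn_addr.
by rewrite nth_cat fds.
Qed.

(** Indices count from the head of the environment, so values appended at its end are invisible.
    Code written for one variable can thus run under an [ELet]. *)
Lemma eval_env ds env env' e v t : Defs.eval ds env e v t ->
  Defs.eval ds (env ++ env') e v t.
Proof.
move=> H; elim: H env' => {env e v t} /=; try by [econstructor; eauto].
move=> env i iE env'.
have -> : nth (VNum 0) env i = nth (VNum 0) (env ++ env') i.
  by rewrite nth_cat iE.
by apply: ev_var; rewrite size_cat ltn_addr.
Qed.

(** * Encodable types with a size measure *)

(* The measure msr only has to bound the size of the encoding: polynomial time
   is relative to it. *)
Class data (T : Type) := Data {
  enc : T -> Defs.val;
  msr : T -> nat;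
  vsize_enc : forall x, (vsize (enc x) <= msr x)%N }.

#[global] Instance data_rat : data rat := Data (fun r => leqnn (vsize (VNum r))).

Lemma vsize_bool (b : bool) : (vsize (VNum (if b then 1%R else 0%R)) <= 3)%N.
Proof. by case: b. Qed.

#[global] Instance data_bool : data bool := Data vsize_bool.

Lemma vsize_prod A B {dA : data A} {dB : data B} (x : A * B) :
  (vsize (VPair (enc x.1) (enc x.2)) <= (msr x.1 + msr x.2).+1)%N.
Proof. by rewrite /= add1n addSn ltnS leq_add ?vsize_enc. Qed.

#[global] Instance data_prod A B {dA : data A} {dB : data B} : data (A * B) :=
  Data (@vsize_prod A B dA dB).

(** The 2 is [enclen 0], the size of the leaf that ends a list. *)
Lemma vsize_seq A {dA : data A} (s : seq A) :
  (vsize (enc_seq (map enc s)) <= foldr (fun a k => (msr a + k).+1) 2 s)%N.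
Proof.
by elim: s => //= a s IH; rewrite add1n addSn ltnS leq_add ?vsize_enc.
Qed.

#[global] Instance data_seq A {dA : data A} : data (seq A) :=
  Data (@vsize_seq A dA).

Arguments msr {T data} x : simpl never.

Lemma msr_pair A B {dA : data A} {dB : data B} (p : A * B) :
  msr p = (msr p.1 + msr p.2).+1.
Proof. by []. Qed.

Lemma msr_cons A {dA : data A} (a : A) s : msr (a :: s) = (msr a + msr s).+1.
Proof. by []. Qed.

Lemma msr_seqE A {dA : data A} (s : seq A) :
  msr s = (2 + \sum_(a <- s) (msr a).+1)%N.
Proof.
elim: s => [|a s IH]; first by rewrite big_nil.
by rewrite big_cons msr_cons IH; lia.
Qed.

Lemma msr_cat A {dA : data A} (s1 s2 : seq A) :
  (msr (s1 ++ s2) + 2 = msr s1 + msr s2)%N.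
Proof. by rewrite !msr_seqE big_cat /=; lia. Qed.

Lemma size_msr A {dA : data A} (s : seq A) : (size s <= msr s)%N.
Proof.
by rewrite msr_seqE; elim: s => [|a s IH] //; rewrite big_cons /=; lia.
Qed.

Lemma msr_mem A {dA : data A} (s1 s2 : seq A) a :
  (msr a <= msr (s1 ++ a :: s2))%N.
Proof. by rewrite !msr_seqE big_cat big_cons /=; lia. Qed.

(** * Polynomially bounded functions *)

Section Polyb.
Context {A : Type} {dA : data A}.
Implicit Types T U : A -> nat.

(** The base is at least 2 at every argument, so constants and sums are absorbed by a larger
    exponent. *)
Definition polyb T := exists k, forall x, (T x <= (msr x).+2 ^ k)%N.

Lemma polyb_le T U : (forall x, (T x <= U x)%N) -> polyb U -> polyb T.
Proof. by move=> TU [k Uk]; exists k => x; apply: leq_trans (TU x) _. Qed.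

Lemma polyb_const c : polyb (fun=> c).
Proof.
exists c => x; apply: leq_trans (ltnW (ltn_expl c (ltnSn 1))) _.
by case: c => // c; rewrite leq_exp2r.
Qed.

Lemma polyb_msr : polyb msr.
Proof. by exists 1%N => x; rewrite expn1; lia. Qed.

Lemma polybD T U : polyb T -> polyb U -> polyb (fun x => (T x + U x)%N).
Proof.
move=> [k Tk] [l Ul]; exists (maxn k l).+1 => x.
rewrite expnS; apply: (@leq_trans (2 * (msr x).+2 ^ maxn k l)).
  rewrite mul2n -addnn; apply: leq_add.
    by apply: leq_trans (Tk x) _; rewrite leq_exp2l // leq_maxl.
  by apply: leq_trans (Ul x) _; rewrite leq_exp2l // leq_maxr.
by rewrite leq_mul2r; apply/orP; right; lia.
Qed.

Lemma polybS T : polyb T -> polyb (fun x => (T x).+1).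
Proof.
move=> pT; apply: polyb_le (polybD (polyb_const 1) pT) => x.
by rewrite add1n.
Qed.

Lemma polybM T U : polyb T -> polyb U -> polyb (fun x => (T x * U x)%N).
Proof.
move=> [k Tk] [l Ul]; exists (k + l)%N => x.
by rewrite expnD leq_mul.
Qed.

Lemma polybX T k : polyb T -> polyb (fun x => (T x ^ k)%N).
Proof.
move=> pT; elim: k => [|k IH]; first exact: (polyb_const 1).
by apply: polyb_le (polybM pT IH) => x; rewrite expnS.
Qed.

End Polyb.

Lemma polyb_comp A B {dA : data A} {dB : data B} (f : A -> B) (T : B -> nat) :
  polyb T -> polyb (fun x => msr (f x)) -> polyb (fun x => T (f x)).
Proof.
move=> [k Tk] pf.
by apply: polyb_le (polybX k (polybS (polybS pf))) => x.
Qed.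

Ltac polyb :=
  lazymatch goal with
  | |- polyb (fun x => addn (@?T x) (@?U x)) =>
      apply: (@polybD _ _ T U); polyb
  | |- polyb (fun x => S (@?T x)) => apply: (@polybS _ _ T); polyb
  | |- polyb (fun x => muln (@?T x) (@?U x)) =>
      apply: (@polybM _ _ T U); polyb
  | |- polyb (fun x => expn (@?T x) ?k) => apply: (@polybX _ _ T k); polyb
  | |- _ => first [assumption | exact: polyb_const | exact: polyb_msr | idtac]
  end.

(** * Functions computed in polynomial time *)

Definition runs A B {dA : data A} {dB : data B} (ds : seq expr) (e : expr)
    (f : A -> B) (T : A -> nat) :=
  forall x, exists2 t, (t <= T x)%N & Defs.eval ds [:: enc x] e (enc (f x)) t.

(** The measure of the result is bounded separately from the time, since it may exceed the size of
    the encoding; compositions rely on it. *)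
Definition PT A B {dA : data A} {dB : data B} (f : A -> B) :=
  exists ds e T, [/\ runs ds e f T, polyb T & polyb (fun x => msr (f x))].

Lemma runs_app A B {dA : data A} {dB : data B} ds ds' e (f : A -> B) T :
  runs ds e f T -> runs (ds ++ ds') e f T.
Proof. by move=> H x; have [t tT ?] := H x; exists t => //; apply: eval_app. Qed.

Lemma runs_shift A B {dA : data A} {dB : data B} ds0 ds e (f : A -> B) T :
  runs ds e f T ->
  runs (ds0 ++ map (shift (size ds0)) ds) (shift (size ds0) e) f T.
Proof.
by move=> H x; have [t tT ?] := H x; exists t => //; apply: eval_shift.
Qed.

Lemma PT_link A B A' B' {dA : data A} {dB : data B} {dA' : data A'}
    {dB' : data B'} (f : A -> B) (g : A' -> B') : PT f -> PT g ->
  exists ds e1 e2 T1 T2, [/\ runs ds e1 f T1, runs ds e2 g T2,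
    polyb T1 & polyb T2].
Proof.
move=> [ds1 [e1 [T1 [r1 p1 _]]]] [ds2 [e2 [T2 [r2 p2 _]]]].
exists (ds1 ++ map (shift (size ds1)) ds2), e1, (shift (size ds1) e2), T1, T2.
by split=> //; [apply: runs_app | apply: runs_shift].
Qed.

Lemma PT_msr A B {dA : data A} {dB : data B} (f : A -> B) :
  PT f -> polyb (fun x => msr (f x)).
Proof. by move=> [? [? [? []]]]. Qed.

Section Rules.
Context {G : Type} {dG : data G}.

Lemma PT_id : PT (fun x : G => x).
Proof.
exists [::], (EVar 0), msr; split; [|exact: polyb_msr..].
move=> x; exists (vsize (enc x)); first exact: vsize_enc.
by apply: (@ev_var [::] [:: enc x] 0).
Qed.

Lemma PT_rat (r : rat) : PT (fun _ : G => r).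
Proof.
exists [::], (EConst r), (fun=> enclen r); split; [|exact: polyb_const..].
by move=> x; exists (enclen r) => //; apply: ev_const.
Qed.

Lemma PT_nil A {dA : data A} : PT (fun _ : G => [::] : seq A).
Proof.
exists [::], (EConst 0), (fun=> enclen 0); split; [|exact: polyb_const..].
by move=> x; exists (enclen 0) => //; apply: ev_const.
Qed.

Lemma PT_bool (b : bool) : PT (fun _ : G => b).
Proof.
have [ds [e [T [r p _]]]] := PT_rat (if b then 1 else 0).
by exists ds, e, T; split=> //; exact: polyb_const.
Qed.

Lemma PT_comp A B {dA : data A} {dB : data B} (g : A -> B) (f : G -> A) :
  PT g -> PT f -> PT (fun x => g (f x)).
Proof.
move=> pg pf; have [ds [e1 [e2 [T1 [T2 [r1 r2 p1 p2]]]]]] := PT_link pg pf.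
exists ds, (ELet e2 e1), (fun x => (T2 x + T1 (f x)).+1); split.
- move=> x; have [t2 t2T ev2] := r2 x; have [t1 t1T ev1] := r1 (f x).
  exists (t2 + t1).+1; first by rewrite ltnS leq_add.
  by apply: (ev_let ev2); apply: (@eval_env ds [:: enc (f x)] [:: enc x]).
- by polyb; apply: polyb_comp => //; apply: PT_msr.
- by apply: (polyb_comp (T := fun y => msr (g y))); exact: PT_msr.
Qed.

Lemma PT_pair A B {dA : data A} {dB : data B} (f : G -> A) (g : G -> B) :
  PT f -> PT g -> PT (fun x => (f x, g x)).
Proof.
move=> pf pg; have [ds [e1 [e2 [T1 [T2 [r1 r2 p1 p2]]]]]] := PT_link pf pg.
exists ds, (EPair e1 e2), (fun x => (T1 x + T2 x).+1); split.
- move=> x; have [t1 t1T ev1] := r1 x; have [t2 t2T ev2] := r2 x.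
  exists (t1 + t2).+1; first by rewrite ltnS leq_add.
  exact: ev_pair.
- by polyb.
- by apply: polybS; apply: polybD; apply: PT_msr.
Qed.

Lemma PT_fst A B {dA : data A} {dB : data B} (f : G -> A * B) :
  PT f -> PT (fun x => (f x).1).
Proof.
move=> [ds [e [T [r p q]]]]; exists ds, (EFst e), (fun x => (T x).+1); split.
- move=> x; have [t tT ev] := r x; exists t.+1 => //.
  by apply: (ev_fst (v2 := enc (f x).2)).
- by polyb.
- by apply: polyb_le q => x; rewrite msr_pair; lia.
Qed.

Lemma PT_snd A B {dA : data A} {dB : data B} (f : G -> A * B) :
  PT f -> PT (fun x => (f x).2).
Proof.
move=> [ds [e [T [r p q]]]]; exists ds, (ESnd e), (fun x => (T x).+1); split.
- move=> x; have [t tT ev] := r x; exists t.+1 => //.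
  by apply: (ev_snd (v1 := enc (f x).1)).
- by polyb.
- by apply: polyb_le q => x; rewrite msr_pair; lia.
Qed.

(** A nonempty list is encoded and measured like the pair of its head and its tail, so the program
    for the pair serves. *)
Lemma PT_cons A {dA : data A} (f : G -> A) (g : G -> seq A) :
  PT f -> PT g -> PT (fun x => f x :: g x).
Proof.
move=> pf pg; have [ds [e [T [r p q]]]] := PT_pair pf pg.
by exists ds, e, T.
Qed.

(** Taking both branches as one pair leaves only two programs to link. Computing the other branch as
    well is harmless, since both are polynomial on every input. *)
Lemma PT_if A {dA : data A} (c : G -> bool) (f g : G -> A) :
  PT c -> PT f -> PT g -> PT (fun x => if c x then f x else g x).
Proof.
move=> pc pf pg; have pfg := PT_pair pf pg.
have [ds [e1 [e2 [T1 [T2 [r1 r2 p1 p2]]]]]] := PT_link pc pfg.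
exists ds, (EIf e1 (EFst e2) (ESnd e2)), (fun x => (T1 x + (T2 x).+1).+1).
split.
- move=> x; have [t1 t1T ev1] := r1 x; have [t2 t2T ev2] := r2 x.
  exists (t1 + t2.+1).+1; first by rewrite ltnS leq_add.
  move: ev1; rewrite /=; case: (c x) => ev1.
    by apply: (ev_if_true _ ev1) => //; apply: (ev_fst (v2 := enc (g x))).
  by apply: (ev_if_false _ ev1) => //; apply: (ev_snd (v1 := enc (f x))).
- by polyb.
- apply: polyb_le (polybD (PT_msr pf) (PT_msr pg)) => x.
  by case: (c x); lia.
Qed.

End Rules.

Lemma leq_exp2r_w (a b k : nat) : (a <= b -> a ^ k <= b ^ k)%N.
Proof. by case: k => // k ab; rewrite leq_exp2r. Qed.

(** Elements are located by splitting the list because [A] need not have decidable equality. *)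
Lemma leq_sum_split A (F : A -> nat) (l : seq A) c :
  (forall l1 a l2, l = l1 ++ a :: l2 -> (F a <= c)%N) ->
  (\sum_(a <- l) F a <= size l * c)%N.
Proof.
elim: l => [|a l IH] H; first by rewrite big_nil.
rewrite big_cons /= mulSn leq_add //; first exact: (H [::] a l).
by apply: IH => l1 b l2 E; apply: (H (a :: l1) b l2); rewrite E.
Qed.

(** * Structural recursion over lists *)

Section Fold.
Context {G A B : Type} {dG : data G} {dA : data A} {dB : data B}.

Lemma polyb_sum (T : G -> A -> nat) (l : G -> seq A) :
  polyb (fun p : G * A => T p.1 p.2) -> polyb (fun x => msr (l x)) ->
  polyb (fun x => (\sum_(a <- l x) T x a)%N).
Proof.
move=> [k Tk] pl.
apply: (@polyb_le _ _ _
  (fun x => msr (l x) * (msr x + msr (l x)).+3 ^ k)%N); last by polyb.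
move=> x; apply: (@leq_trans (size (l x) * (msr x + msr (l x)).+3 ^ k)).
  apply: leq_sum_split => l1 a l2 E.
  apply: leq_trans (Tk (x, a)) _; apply: leq_exp2r_w.
  have al : (msr a <= msr (l x))%N by rewrite E msr_mem.
  by rewrite msr_pair /=; lia.
by rewrite leq_mul2r size_msr orbT.
Qed.

(** Iterating a polynomial step can blow up exponentially, so [U] bounds the measures of all
    intermediate results, which are the folds of the suffixes of the list. *)
Lemma PT_foldr (h : G -> A -> B -> B) (i : G -> B) (l : G -> seq A)
    (U : G -> nat) :
  polyb U ->
  (forall x l1 l2, l x = l1 ++ l2 -> (msr (foldr (h x) (i x) l2) <= U x)%N) ->
  PT (fun p : G * A * B => h p.1.1 p.1.2 p.2) -> PT i -> PT l ->
  PT (fun x => foldr (h x) (i x) (l x)).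
Proof.
move=> pU hU ph pi pl.
have [ds [e1 [e2 [T1 [T2 [r1 r2 p1 p2]]]]]] := PT_link (PT_pair pi pl) ph.
have [k Tk] := p2; have qi := PT_msr pi; have ql := PT_msr pl.
pose V := EVar 0.
(* The argument is the pair of [x] and the remaining list: a definition sees nothing but its
   argument, so [x] travels along. The body is put after [ds] and calls itself by the number
   [size ds]. *)
pose body := EIf (EIsPair (ESnd V))
  (ELet (EPair (EPair (EFst V) (EFst (ESnd V)))
     (ECall (size ds) (EPair (EFst V) (ESnd (ESnd V))))) e2)
  (ELet (EFst V) (EFst e1)).
pose ds' := ds ++ [:: body].
(* [W] bounds the cost of one level of the recursion, including the copies of its argument. *)
pose (W := fun x => (6 * (msr x + msr (l x)) + 40 + T1 x
                     + (msr x + msr (l x) + U x + 6) ^ k)%N).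
have evV (v : Defs.val) : Defs.eval ds' [:: v] V v (vsize v).
  exact: (@ev_var ds' [:: v] 0).
have main x l1 l2 : l x = l1 ++ l2 ->
    exists2 t, (t <= (size l2).+1 * W x)%N
    & Defs.eval ds' [:: VPair (enc x) (enc l2)] body
        (enc (foldr (h x) (i x) l2)) t.
  elim: l2 l1 => [|a l2 IH] l1 E.
    have [t1 t1T ev1] := r1 x.
    set v := VPair _ _; set s := vsize v.
    have sE : (s <= (msr x).+4)%N.
        have e0 : enclen 0 = 2%N by [].
      rewrite /s /v /= e0; pose proof (vsize_enc x); lia.
    exists ((s.+1 + 2).+1 + ((s.+1 + t1.+1).+1)).+1.
      by rewrite mul1n /W; lia.
    apply: ev_if_false; first exact: (ev_ispair (v := enc ([::] : seq A))
      (ev_snd (v1 := enc x) (evV v))).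
    apply: (ev_let (v1 := enc x)); first exact: (ev_fst (v2 := VNum 0) (evV v)).
    apply: (ev_fst (v2 := enc (l x))).
    exact: (@eval_env _ [:: enc x]) (eval_app _ ev1).
  have [t tW ev] := IH (rcons l1 a) (etrans E (esym (cat_rcons _ _ _))).
  set b := foldr (h x) (i x) l2 in ev *.
  have [t2 t2T ev2] := r2 (x, a, b).
  set v := VPair _ _; set s := vsize v.
  have al : (msr (a :: l2) <= msr (l x))%N.
    by rewrite E !msr_seqE big_cat /=; lia.
  have sE : (s <= (msr x + msr (l x)).+1)%N.
    pose proof (vsize_enc x); pose proof (vsize_enc (a :: l2)).
    have -> : s = (1 + vsize (enc x) + vsize (enc (a :: l2)))%N by [].
    by lia.
  have t2W : (t2 <= (msr x + msr (l x) + U x + 6) ^ k)%N.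
    apply: leq_trans t2T (leq_trans (Tk _) _).
    apply: leq_exp2r_w; rewrite !msr_pair /=.
    have bU := hU x (rcons l1 a) l2 (etrans E (esym (cat_rcons _ _ _))).
    by rewrite msr_cons -/b in al bU *; lia.
  exists ((s.+1 + 2).+1 +
    (((s.+1 + s.+2).+1 + ((s.+1 + s.+2).+1 + t).+1).+1 + t2).+1).+1.
    have WE : (6 * (msr x + msr (l x)) + 40 +
        (msr x + msr (l x) + U x + 6) ^ k <= W x)%N by rewrite /W; lia.
    by rewrite [size _]/= mulSn; lia.
  have evs : Defs.eval ds' [:: v] (ESnd V) (enc (a :: l2)) s.+1.
    exact: (ev_snd (v1 := enc x) (evV v)).
  have evx : Defs.eval ds' [:: v] (EFst V) (enc x) s.+1.
    exact: (ev_fst (v2 := enc (a :: l2)) (evV v)).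
  apply: (ev_if_true _ (ev_ispair evs)) => //.
  apply: (ev_let (v1 := enc (x, a, b))); last first.
    exact: (@eval_env _ [:: enc (x, a, b)]) (eval_app _ ev2).
  apply: ev_pair.
    apply: ev_pair => //.
    exact: (ev_fst (v2 := enc l2) evs).
  apply: (ev_call (v := VPair (enc x) (enc l2))).
  - by rewrite size_cat addn1.
  - apply: ev_pair => //.
    exact: (ev_snd (v1 := enc a) evs).
  - by rewrite nth_cat ltnn subnn.
exists ds', (ECall (size ds) (EPair V (ESnd e1))),
  (fun x => ((msr x + (T1 x).+1).+1 + (size (l x)).+1 * W x).+1)%N.
split.
- move=> x; have [t1 t1T ev1] := r1 x; have [t tW ev] := main x [::] (l x) erefl.
  exists ((vsize (enc x) + t1.+1).+1 + t).+1.
    by pose proof (vsize_enc x); lia.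
  apply: (ev_call (v := VPair (enc x) (enc (l x)))).
  - by rewrite size_cat addn1.
  - apply: ev_pair => //.
    exact: (ev_snd (v1 := enc (i x)) (eval_app _ ev1)).
  - by rewrite nth_cat ltnn subnn.
- apply: (@polyb_le _ _ _
    (fun x => ((msr x + (T1 x).+1).+1 + (msr (l x)).+1 * W x).+1)%N).
    by move=> x; rewrite ltnS leq_add2l leq_mul2r ltnS size_msr orbT.
  by rewrite /W; polyb.
- by apply: polyb_le pU => x; apply: (hU x [::] (l x)).
Qed.

End Fold.

(** * Heights of rational numbers *)

(* Unlike the encoding length, whose bound for sums doubles, the logarithm of
   the height is subadditive for sums and for products. *)
Definition ht (r : rat) : nat := (`|numq r| + `|denq r|)%N.

Lemma ht_frac (a b : int) : b != 0 ->
  (ht (a%:Q / b%:Q) <= `|a| + `|b|)%N.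
Proof.
case: divqP => [_|k x k0] // _; rewrite /ht !abszM.
by apply: leq_add; apply: leq_pmull; rewrite absz_gt0.
Qed.

Lemma denq_absz_gt0 r : (0 < `|denq r|)%N.
Proof. by rewrite absz_gt0 denq_neq0. Qed.

(** Numerator and denominator of the unreduced sum use three of the four terms in the expanded
    product of the heights, and reduction only lowers the height. *)
Lemma htD r s : (ht (r + s) <= ht r * ht s)%N.
Proof.
have dr : (denq r)%:~R != 0 :> rat by rewrite intr_eq0 denq_neq0.
have ds : (denq s)%:~R != 0 :> rat by rewrite intr_eq0 denq_neq0.
have -> : r + s =
    (numq r * denq s + numq s * denq r)%:~R / (denq r * denq s)%:~R.
  rewrite intrD !intrM !numqE; field.
  by rewrite dr ds.
apply: leq_trans (ht_frac _ _) _; first by rewrite mulf_neq0 ?denq_neq0.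
have H : forall a b : int, (absz (a + b)%R <= absz a + absz b)%N by lia.
by apply: leq_trans (leq_add (H _ _) (leqnn _)) _; rewrite /ht !abszM; nia.
Qed.

Lemma htM r s : (ht (r * s) <= ht r * ht s)%N.
Proof.
rewrite -[r in (r * s)]divq_num_den -[s in (_ * s)]divq_num_den.
rewrite mulrACA -invfM -!intrM.
apply: leq_trans (ht_frac _ _) _; first by rewrite mulf_neq0 ?denq_neq0.
by rewrite !abszM /ht; nia.
Qed.

Lemma htN r : ht (- r) = ht r.
Proof. by rewrite /ht numqN denqN abszN. Qed.

Lemma htV r : (ht r^-1 <= ht r)%N.
Proof.
have [->|r0] := eqVneq r 0; first by rewrite invr0.
have -> : r^-1 = (denq r)%:~R / (numq r)%:~R.
  by rewrite -[r in LHS]divq_num_den invf_div.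
apply: leq_trans (ht_frac _ _) _; first by rewrite numq_eq0.
by rewrite addnC.
Qed.

Lemma ht_int (n : int) : ht n%:~R = `|n|.+1.
Proof. by rewrite /ht numq_int denq_int addn1. Qed.

Lemma ht_enclen r : (ht r <= 2 ^ enclen r)%N.
Proof.
have p := up_logP (1 + `|numq r|) (ltnSn 1).
have q := up_logP (1 + `|denq r|) (ltnSn 1).
rewrite /ht /enclen !expnD expn1.
move: p q; set u := (2 ^ _)%N; set w := (2 ^ _)%N => p q.
by nia.
Qed.

(** Numerator and denominator may each be as large as about 2^k, whence the factor 2. *)
Lemma enclen_ht r k : (ht r <= 2 ^ k -> enclen r <= 2 * k + 3)%N.
Proof.
move=> rk.
have b j : (j <= ht r)%N -> (up_log 2 (1 + j) <= k.+1)%N.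
  move=> jr; apply: up_log_min => //.
  have := expn_gt0 2 k; rewrite expnS; lia.
have := b _ (leq_addr _ _ : `|numq r| <= ht r)%N.
have := b _ (leq_addl _ _ : `|denq r| <= ht r)%N.
by rewrite /enclen; lia.
Qed.

Lemma enclenD r s : (enclen (r + s) <= 2 * (enclen r + enclen s) + 3)%N.
Proof.
apply: enclen_ht; apply: leq_trans (htD r s) _.
by rewrite expnD leq_mul ?ht_enclen.
Qed.

Lemma enclenM r s : (enclen (r * s) <= 2 * (enclen r + enclen s) + 3)%N.
Proof.
apply: enclen_ht; apply: leq_trans (htM r s) _.
by rewrite expnD leq_mul ?ht_enclen.
Qed.

Lemma enclenN r : enclen (- r) = enclen r.
Proof. by rewrite /enclen numqN denqN abszN. Qed.

Lemma enclen_int_denq r : (enclen (denq r)%:~R <= 2 * enclen r + 5)%N.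
Proof.
apply: (@leq_trans (2 * (enclen r).+1 + 3)); last by lia.
apply: enclen_ht; rewrite ht_int expnS.
by have := ht_enclen r; have := expn_gt0 2 (enclen r); rewrite /ht; lia.
Qed.

Lemma enclen_sum A (F : A -> rat) s :
  (enclen (\sum_(a <- s) F a) <= 2 * (\sum_(a <- s) enclen (F a)) + 3)%N.
Proof.
apply: enclen_ht; elim: s => [|a s IH]; first by rewrite !big_nil.
rewrite !big_cons; apply: leq_trans (htD _ _) _.
by rewrite expnD leq_mul ?ht_enclen.
Qed.

(** The [.+1] pays for the height 2 of the empty product; the empty sum has height 1. *)
Lemma enclen_prod A (F : A -> rat) s :
  (enclen (\prod_(a <- s) F a) <= 2 * (\sum_(a <- s) enclen (F a)).+1 + 3)%N.
Proof.
apply: enclen_ht; elim: s => [|a s IH]; first by rewrite !big_nil.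
rewrite !big_cons; apply: leq_trans (htM _ _) _.
by rewrite -addnS expnD leq_mul ?ht_enclen.
Qed.

(** * Polynomial-time arithmetic *)

Section Arith.
Context {G : Type} {dG : data G}.
Implicit Types (f g : G -> rat) (b c : G -> bool).

Lemma PT_ext A {dA : data A} (f f' : G -> A) :
  (forall x, f x = f' x) -> PT f -> PT f'.
Proof. by move=> /funext ->. Qed.

Lemma PT_un (o : unop) f (h : rat -> nat) :
  (forall r, (enclen (un_sem o r) <= h r)%N) -> polyb h ->
  PT f -> PT (fun x => un_sem o (f x)).
Proof.
move=> hr ph pf; have qf := PT_msr pf; case: pf => [ds [e [T [r p _]]]].
exists ds, (EUn o e), (fun x => (T x + msr (f x) ^ 2)%N); split.
- move=> x; have [t tT ev] := r x.
  exists (t + enclen (f x) ^ 2)%N; first by rewrite leq_add2r.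
  exact: ev_un.
- by polyb.
- apply: (@polyb_le _ _ _ (fun x => h (f x))) => [x|]; first exact: hr.
  exact: polyb_comp.
Qed.

Lemma PT_opp f : PT f -> PT (fun x => - f x).
Proof.
apply: (@PT_un OOpp f (fun r => msr r)) => [r|]; last by polyb.
by rewrite /= enclenN.
Qed.

Lemma PT_inv f : PT f -> PT (fun x => (f x)^-1).
Proof.
apply: (@PT_un Defs.OInv f (fun r => 2 * msr r + 3)%N) => [r|]; last by polyb.
by apply: enclen_ht; apply: leq_trans (htV r) (ht_enclen r).
Qed.

Lemma PT_denq f : PT f -> PT (fun x => (denq (f x))%:~R : rat).
Proof.
apply: (@PT_un ODen f (fun r => 2 * msr r + 5)%N) => [r|]; last by polyb.
exact: enclen_int_denq.
Qed.

Lemma runs_bin (o : binop) f g : PT f -> PT g -> exists ds e T,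
  runs ds e (fun x => bin_sem o (f x) (g x)) T /\ polyb T.
Proof.
move=> pf pg; have qf := PT_msr pf; have qg := PT_msr pg.
have [ds [e1 [e2 [T1 [T2 [r1 r2 p1 p2]]]]]] := PT_link pf pg.
exists ds, (EBin o e1 e2),
  (fun x => (T1 x + T2 x + (msr (f x) + msr (g x)) ^ 2)%N).
split; last by polyb.
move=> x; have [t1 t1T ev1] := r1 x; have [t2 t2T ev2] := r2 x.
exists (t1 + t2 + (enclen (f x) + enclen (g x)) ^ 2)%N.
  by rewrite leq_add2r leq_add.
exact: ev_bin.
Qed.

Lemma PT_add f g : PT f -> PT g -> PT (fun x => f x + g x).
Proof.
move=> pf pg; have [ds [e [T [r p]]]] := runs_bin OAdd pf pg.
exists ds, e, T; split=> //.
have qf := PT_msr pf; have qg := PT_msr pg.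
apply: (@polyb_le _ _ _ (fun x => 2 * (msr (f x) + msr (g x)) + 3)%N).
  by move=> x; exact: enclenD.
by polyb.
Qed.

Lemma PT_mul f g : PT f -> PT g -> PT (fun x => f x * g x).
Proof.
move=> pf pg; have [ds [e [T [r p]]]] := runs_bin OMul pf pg.
exists ds, e, T; split=> //.
have qf := PT_msr pf; have qg := PT_msr pg.
apply: (@polyb_le _ _ _ (fun x => 2 * (msr (f x) + msr (g x)) + 3)%N).
  by move=> x; exact: enclenM.
by polyb.
Qed.

Lemma PT_le f g : PT f -> PT g -> PT (fun x => f x <= g x).
Proof.
move=> pf pg; have [ds [e [T [r p]]]] := runs_bin OLe pf pg.
by exists ds, e, T; split=> //; exact: polyb_const.
Qed.

Lemma PT_negb b : PT b -> PT (fun x => ~~ b x).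
Proof. by move=> pb; apply: PT_if => //; exact: PT_bool. Qed.

Lemma PT_andb b c : PT b -> PT c -> PT (fun x => b x && c x).
Proof. by move=> pb pc; apply: PT_if => //; exact: PT_bool. Qed.

Lemma PT_eq f g : PT f -> PT g -> PT (fun x => f x == g x).
Proof.
move=> pf pg; apply: PT_ext (PT_andb (PT_le pf pg) (PT_le pg pf)) => x.
by rewrite eq_le.
Qed.

Lemma PT_norm f : PT f -> PT (fun x => `|f x|).
Proof.
move=> pf.
apply: (@PT_ext _ _ (fun x => if 0 <= f x then f x else - f x)) => [x|].
  by case: lerP => fx; [rewrite ger0_norm | rewrite ltr0_norm].
by apply: PT_if; [apply: PT_le => //; exact: PT_rat | | exact: PT_opp].
Qed.

End Arith.

(** * Polynomial-time list operations *)

Section ListOps.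
Context {G A B : Type} {dG : data G} {dA : data A} {dB : data B}.

Lemma PT_map (h : G -> A -> B) (l : G -> seq A) :
  PT (fun p : G * A => h p.1 p.2) -> PT l -> PT (fun x => map (h x) (l x)).
Proof.
move=> ph pl; have qh := PT_msr ph; have ql := PT_msr pl.
apply: (@PT_ext _ _ _ _ (fun x => foldr (fun a s => h x a :: s) [::] (l x))).
  by move=> x; elim: (l x) => //= a s ->.
apply: (PT_foldr (U := fun x => 2 + \sum_(a <- l x) (msr (h x a)).+1)%N).
- polyb; apply: (polyb_sum (T := fun x a => (msr (h x a)).+1)) => //.
  by polyb.
- move=> x l1 l2 ->; rewrite big_cat /=.
  have -> : foldr (fun a s => h x a :: s) [::] l2 = map (h x) l2.
    by elim: l2 => //= a s ->.
  by rewrite msr_seqE big_map; lia.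
- apply: PT_cons; last by apply: PT_snd; exact: PT_id.
  apply: (PT_comp ph); apply: PT_fst; exact: PT_id.
- exact: PT_nil.
- by [].
Qed.

Lemma PT_cat (f g : G -> seq A) : PT f -> PT g -> PT (fun x => f x ++ g x).
Proof.
move=> pf pg; have qf := PT_msr pf; have qg := PT_msr pg.
have E0 (s t : seq A) : foldr cons t s = s ++ t by elim: s => //= a s ->.
apply: (PT_ext (fun x => E0 (f x) (g x))).
apply: (PT_foldr (h := fun _ a s => a :: s) (i := g)
  (U := fun x => msr (f x) + msr (g x))%N) => //; first by polyb.
- move=> x l1 l2 E; rewrite E0.
  by rewrite !msr_seqE E !big_cat /=; lia.
- apply: PT_cons; last by apply: PT_snd; exact: PT_id.
  by apply: PT_snd; apply: PT_fst; exact: PT_id.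
Qed.

Lemma PT_head (d : G -> A) (l : G -> seq A) :
  PT d -> PT l -> PT (fun x => head (d x) (l x)).
Proof.
move=> pd pl; have qd := PT_msr pd; have ql := PT_msr pl.
apply: (@PT_ext _ _ _ _ (fun x => foldr (fun a s => a) (d x) (l x))).
  by move=> x; case: (l x).
apply: (PT_foldr (U := fun x => msr (d x) + msr (l x))%N) => //; first by polyb.
- move=> x l1 l2 ->; case: l2 => [|a l2] /=; first exact: leq_addr.
  by apply: leq_trans (leq_addl _ _); exact: msr_mem.
- by apply: PT_snd; apply: PT_fst; exact: PT_id.
Qed.

End ListOps.

Lemma PT_flatten G A {dG : data G} {dA : data A} (l : G -> seq (seq A)) :
  PT l -> PT (fun x => flatten (l x)).
Proof.
move=> pl; have ql := PT_msr pl.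
apply: (PT_foldr (h := fun _ a s => a ++ s) (i := fun=> [::])
  (U := fun x => msr (l x))) => //.
- move=> x l1 l2 ->; apply: (@leq_trans (msr l2)); last first.
    by rewrite !msr_seqE big_cat /=; lia.
  rewrite -/(flatten l2); elim: l2 => [|a l2 IH] //=.
  by rewrite msr_cons -(leq_add2r 2) msr_cat; lia.
- by apply: PT_cat; apply: PT_snd; [apply: PT_fst|]; exact: PT_id.
- exact: PT_nil.
Qed.

Section Big.
Context {G A : Type} {dG : data G} {dA : data A}.
Implicit Types (l : G -> seq A).

(** Applying [enclenD] at each addition would double the bound every time; [enclen_sum] bounds all
    partial sums linearly in the total length of the terms. *)
Lemma PT_sum (F : G -> A -> rat) l : PT (fun p : G * A => F p.1 p.2) -> PT l ->
  PT (fun x => \sum_(a <- l x) F x a).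
Proof.
move=> pF pl; have qF := PT_msr pF; have ql := PT_msr pl.
have E x s : foldr (fun a r => F x a + r) 0 s = \sum_(a <- s) F x a.
  by elim: s => [|a s IH]; rewrite ?big_nil // big_cons -IH.
apply: (PT_ext (fun x => E x (l x))).
refine (PT_foldr (h := fun x a r => F x a + r) (i := fun=> 0) (l := l)
  (U := fun x => (2 * (\sum_(a <- l x) msr (F x a)) + 3)%N) _ _ _ _ pl).
- by polyb; apply: (polyb_sum (T := fun x a => msr (F x a))).
- move=> x l1 l2 lE; rewrite E; apply: leq_trans (enclen_sum _ _) _.
  by rewrite leq_add2r leq_mul2l /= lE big_cat /= leq_addl.
- apply: PT_add; last by apply: PT_snd; exact: PT_id.
  by apply: (PT_comp pF); apply: PT_fst; exact: PT_id.
- exact: PT_rat.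
Qed.

Lemma PT_prod (F : G -> A -> rat) l : PT (fun p : G * A => F p.1 p.2) -> PT l ->
  PT (fun x => \prod_(a <- l x) F x a).
Proof.
move=> pF pl; have qF := PT_msr pF; have ql := PT_msr pl.
have E x s : foldr (fun a r => F x a * r) 1 s = \prod_(a <- s) F x a.
  by elim: s => [|a s IH]; rewrite ?big_nil // big_cons -IH.
apply: (PT_ext (fun x => E x (l x))).
refine (PT_foldr (h := fun x a r => F x a * r) (i := fun=> 1) (l := l)
  (U := fun x => (2 * (\sum_(a <- l x) msr (F x a)).+1 + 3)%N) _ _ _ _ pl).
- by polyb; apply: (polyb_sum (T := fun x a => msr (F x a))).
- move=> x l1 l2 lE; rewrite E; apply: leq_trans (enclen_prod _ _) _.
  by rewrite leq_add2r leq_mul2l /= ltnS lE big_cat /= leq_addl.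
- apply: PT_mul; last by apply: PT_snd; exact: PT_id.
  by apply: (PT_comp pF); apply: PT_fst; exact: PT_id.
- exact: PT_rat.
Qed.

Lemma PT_all (F : G -> A -> bool) l : PT (fun p : G * A => F p.1 p.2) -> PT l ->
  PT (fun x => all (F x) (l x)).
Proof.
move=> pF pl.
apply: (@PT_ext _ _ _ _ (fun x => foldr (fun a r => F x a && r) true (l x))).
  by move=> x; elim: (l x) => //= a s ->.
refine (PT_foldr (h := fun x a r => F x a && r) (i := fun=> true) (l := l)
  (U := fun=> 3%N) _ _ _ _ pl).
- exact: polyb_const.
- by [].
- apply: PT_andb; last by apply: PT_snd; exact: PT_id.
  by apply: (PT_comp pF); apply: PT_fst; exact: PT_id.
- exact: PT_bool.
Qed.

End Big.

(** A hook for the functions of the algorithm, redefined once they exist. *)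
Ltac pt_fun := fail 0.

Ltac pt :=
  lazymatch goal with
  | |- PT (fun x => x) => exact: PT_id
  | |- PT fst => exact: (PT_fst PT_id)
  | |- PT snd => exact: (PT_snd PT_id)
  | |- PT (fun x => (@?f x).1) => apply: (@PT_fst _ _ _ _ _ _ f); pt
  | |- PT (fun x => (@?f x).2) => apply: (@PT_snd _ _ _ _ _ _ f); pt
  | |- PT (fun x => (@?f x, @?g x)) => apply: (PT_pair (f := f) (g := g)); pt
  | |- PT (fun x => [::]) => exact: PT_nil
  | |- PT (fun x => @?f x :: @?g x) => apply: (PT_cons (f := f) (g := g)); pt
  | |- PT (fun x => map (fun a => @?h x a) (@?l x)) =>
      apply: (PT_map (h := h) (l := l)); pt
  | |- PT (fun x => flatten (@?l x)) => apply: (PT_flatten (l := l)); pt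
  | |- PT (fun x => @?f x ++ @?g x) => apply: (PT_cat (f := f) (g := g)); pt
  | |- PT (fun x => all (fun a => @?h x a) (@?l x)) =>
      apply: (PT_all (F := h) (l := l)); pt
  | |- PT (fun x => \sum_(a <- @?l x) (@?h x a)) =>
      apply: (PT_sum (F := h) (l := l)); pt
  | |- PT (fun x => \prod_(a <- @?l x) (@?h x a)) =>
      apply: (PT_prod (F := h) (l := l)); pt
  | |- PT (fun x => @?f x + @?g x) => apply: (PT_add (f := f) (g := g)); pt
  | |- PT (fun x => @?f x * @?g x) => apply: (PT_mul (f := f) (g := g)); pt
  | |- PT (fun x => - @?f x) => apply: (PT_opp (f := f)); pt
  | |- PT (fun x => (@?f x)^-1) => apply: (PT_inv (f := f)); pt
  | |- PT (fun x => `|@?f x|) => apply: (PT_norm (f := f)); pt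
  | |- PT (fun x => (denq (@?f x))%:~R) => apply: (PT_denq (f := f)); pt
  | |- PT (fun x => @?f x <= @?g x) => apply: (PT_le (f := f) (g := g)); pt
  | |- PT (fun x => @?f x == @?g x) => apply: (PT_eq (f := f) (g := g)); pt
  | |- PT (fun x => ~~ @?f x) => apply: (PT_negb (b := f)); pt
  | |- PT (fun x => @?f x && @?g x) => apply: (PT_andb (b := f) (c := g)); pt
  | |- _ => first [pt_fun | exact: PT_rat | exact: PT_bool | assumption | pt_hyp
               | apply: PT_if; pt | idtac]
  end
with pt_hyp :=
  match goal with
  | H : PT ?l |- PT (fun x => ?l (@?f x)) =>
      apply: (PT_comp (g := l) (f := f) H); pt
  end.

(** * Indexed lists *)

(* The indices are computed from the end of the list because this is the
   direction of foldr. *)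
Definition rtag A (l : seq A) : seq (rat * A) :=
  foldr (fun a s => ((head (-1, a) s).1 + 1, a) :: s) [::] l.

Definition tag A (l : seq A) : seq (rat * A) :=
  [seq (\sum_(a <- l) 1 - 1 - p.1, p.2) | p : rat * A <- rtag l].

(** Lookup at a rational index, as a sum with at most one nonzero term; outside the range it gives
    0. *)
Definition nthr (l : seq rat) (k : rat) : rat :=
  \sum_(p <- tag l) (if p.1 == k then p.2 else 0).

Definition idx A (l : seq A) : seq rat := [seq p.1 | p <- tag l].

Definition maxs (l : seq rat) : rat :=
  foldr (fun a r => if a <= r then r else a) 0 l.

(** The default -1 in [rtag] makes the last index 0, so an index is the distance to the end. *)
Lemma rtagE A (l : seq A) :
  rtag l = zip [seq (size l - i.+1)%N%:R | i <- iota 0 (size l)] l.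
Proof.
elim: l => //= a l IH; rewrite -/(rtag l) subn1 /=; congr ((_, _) :: _).
  rewrite IH; case: l {IH} => [|b l] /=; first by rewrite addNr.
  by rewrite subn1 /= -addn1 natrD.
rewrite IH; congr zip; rewrite -[1%N]addn0 iotaDl -map_comp.
by apply: eq_map => i /=; rewrite subSS.
Qed.

Lemma tagE A (l : seq A) : tag l = zip [seq i%:R | i <- iota 0 (size l)] l.
Proof.
rewrite /tag rtagE.
have -> : \sum_(a <- l) 1 = (size l)%:R :> rat.
  by rewrite big_const_seq count_predT iter_addr_0.
have H n : forall (l : seq A) (s : seq nat), {in s, forall i, (i < n)%N} ->
    [seq (n%:R - 1 - p.1, p.2) | p <- zip [seq (n - i.+1)%:R | i <- s] l] =
    zip [seq i%:R | i <- s] l :> seq (rat * A).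
  elim=> [|a l' IH] [|i s] //= si; congr (_ :: _); last first.
    by apply: IH => j js; apply: si; rewrite inE js orbT.
  have ni := si i (mem_head _ _); congr (_, _).
  by rewrite natrB // -addn1 natrD; ring.
by apply: H => i; rewrite mem_iota.
Qed.

Lemma size_tag A (l : seq A) : size (tag l) = size l.
Proof. by rewrite tagE size_zip size_map size_iota minnn. Qed.

Lemma idxE A (l : seq A) : idx l = [seq i%:R | i <- iota 0 (size l)].
Proof. by rewrite /idx tagE -/unzip1 unzip1_zip // size_map size_iota. Qed.

Lemma big_tag (R : Type) (z : R) (op : R -> R -> R) A (a0 : A) (l : seq A) F :
  \big[op/z]_(p <- tag l) F p =
  \big[op/z]_(i < size l) F (i%:R, nth a0 l i).
Proof.
have -> : tag l = [seq (i%:R, nth a0 l i) | i <- iota 0 (size l)].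
  rewrite tagE; apply: (@eq_from_nth _ (0, a0)) => [|i].
    by rewrite size_zip !size_map size_iota minnn.
  rewrite size_zip !size_map size_iota minnn => il.
  rewrite nth_zip ?size_map ?size_iota // !(nth_map 0%N) ?size_iota //.
  by rewrite nth_iota.
rewrite big_map -[in iota _ _](subn0 (size l)) -/(index_iota 0 (size l)).
by rewrite big_mkord.
Qed.

Lemma nthrE (l : seq rat) (k : nat) : nthr l k%:R = l`_k.
Proof.
rewrite /nthr (big_tag _ _ 0) /=.
under eq_bigr do rewrite eqr_nat.
case: (ltnP k (size l)) => kl; last first.
  rewrite nth_default // big1 // => i _.
  by case: eqP => // ik; move: kl; rewrite -ik leqNgt ltn_ord.
rewrite (bigD1 (Ordinal kl)) //= eqxx big1 ?addr0 // => i.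
by rewrite -val_eqE /= => /negbTE ->.
Qed.

Section Indexed.
Context {G A : Type} {dG : data G} {dA : data A}.

Lemma enclen_nat (n : nat) : (enclen n%:R <= 2 * n + 5)%N.
Proof.
have -> : (2 * n + 5 = 2 * n.+1 + 3)%N by lia.
apply: enclen_ht; rewrite -[n%:R]/(n%:~R) ht_int /=.
by have := ltn_expl n.+1 (ltnSn 1); lia.
Qed.

Lemma PT_tag (l : G -> seq A) : PT l -> PT (fun x => tag (l x)).
Proof.
move=> pl; have ql := PT_msr pl.
assert (prt : PT (fun x => rtag (l x))); last by rewrite /tag; pt.
refine (PT_foldr (h := fun _ a (s : seq (rat * A)) => ((head (-1, a) s).1 + 1, a) :: s)
  (i := fun=> [::]) (l := l)
  (U := fun x => (2 + msr (l x) * (2 * msr (l x) + 7 + msr (l x)))%N) _ _ _ _ pl).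
- by polyb.
- move=> x l1 l2 E; rewrite -/(rtag l2).
  have ll : (msr l2 <= msr (l x))%N by rewrite E !msr_seqE big_cat /=; lia.
  rewrite rtagE msr_seqE leq_add2l.
  have H : forall (s : seq A) (j : seq nat), (msr s <= msr (l x))%N ->
      (\sum_(p <- zip [seq (size l2 - i.+1)%N%:R : rat | i <- j] s) (msr p).+1
        <= msr s * (2 * msr (l x) + 7 + msr (l x)))%N.
    elim=> [|a s IH] [|i j] //; rewrite ?big_nil // msr_cons => sl.
    rewrite /= big_cons mulSn -addnA.
    apply: (@leq_trans ((msr (l x) + (2 * msr (l x) + 7)) +
        (msr s * (2 * msr (l x) + 7 + msr (l x))))); last by nia.
    apply: leq_add; last by apply: IH; lia.
    rewrite msr_pair /=.
    pose proof (enclen_nat (size l2 - i.+1) :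
      msr ((size l2 - i.+1)%:R : rat) <= _)%N.
    by pose proof (size_msr l2); lia.
  by apply: leq_trans (H _ _ ll) _; rewrite leq_mul2r ll orbT.
- rewrite /=; pt; apply: (PT_head (d := fun p => (-1, p.1.2))); pt.
- exact: PT_nil.
Qed.

Lemma PT_idx (l : G -> seq A) : PT l -> PT (fun x => idx (l x)).
Proof. by move=> pl; rewrite /idx; pt; exact: PT_tag. Qed.

End Indexed.

Section Numbers.
Context {G : Type} {dG : data G}.

Lemma PT_nthr (l : G -> seq rat) (k : G -> rat) :
  PT l -> PT k -> PT (fun x => nthr (l x) (k x)).
Proof.
move=> pl pk; rewrite /nthr; pt; exact: PT_tag.
Qed.

Lemma PT_maxs (l : G -> seq rat) : PT l -> PT (fun x => maxs (l x)).
Proof.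
move=> pl; have ql := PT_msr pl.
refine (PT_foldr (h := fun _ (a r : rat) => if a <= r then r else a)
  (i := fun=> 0) (l := l) (U := fun x => (2 + msr (l x))%N) _ _ _ _ pl).
- by polyb.
- move=> x l1 l2 ->; apply: (@leq_trans (2 + msr l2)); last first.
    by rewrite !msr_seqE big_cat /=; lia.
  elim: l2 => [|a l2 IH] //=; rewrite msr_cons.
  by case: ifP => _; lia.
- by rewrite /=; pt.
- exact: PT_rat.
Qed.

End Numbers.

(** * Exponential enumeration and powers of two *)

Definition cart A (ls : seq (seq A)) : seq (seq A) :=
  foldr (fun l ws => flatten [seq [seq a :: w | w <- ws] | a <- l]) [:: [::]] ls.

Lemma size_cart A (ls : seq (seq A)) :
  size (cart ls) = (\prod_(l <- ls) size l)%N.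
Proof.
elim: ls => [|l ls IH]; rewrite ?big_nil // big_cons -IH /=.
rewrite size_flatten /shape -map_comp -/(cart ls).
elim: l => //= a l IHl; rewrite IHl size_map; lia.
Qed.

Lemma msr_cart A {dA : data A} (ls : seq (seq A)) :
  (\sum_(w <- cart ls) (msr w).+1 <=
   (\prod_(l <- ls) size l) * (msr ls).+1)%N.
Proof.
elim: ls => [|l ls IH]; first by rewrite big_seq1 big_nil.
rewrite /= -/(cart ls) big_flatten big_map big_cons msr_cons.
rewrite -size_cart in IH *; rewrite -mulnA.
apply: leq_sum_split => l1 a l2 E.
have al : (msr a <= msr l)%N by rewrite E msr_mem.
rewrite big_map.
have -> : (\sum_(w <- cart ls) (msr (a :: w)).+1 =
    size (cart ls) * (msr a).+1 + \sum_(w <- cart ls) (msr w).+1)%N.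
  elim: (cart ls) => [|w ws IHw]; rewrite ?big_nil // !big_cons IHw msr_cons.
  by rewrite /=; lia.
by nia.
Qed.

(** The words of every suffix of [ls] are listed on the way. An empty list makes the product of the
    sizes 0 while a suffix still has many words, hence the successors in the hypothesis. *)
Lemma PT_cart G A {dG : data G} {dA : data A} (ls : G -> seq (seq A)) :
  polyb (fun x => \prod_(l <- ls x) (size l).+1)%N -> PT ls ->
  PT (fun x => cart (ls x)).
Proof.
move=> pp pl; have ql := PT_msr pl.
refine (PT_foldr
  (h := fun _ l ws => flatten [seq [seq a :: w | w <- ws] | a <- l])
  (i := fun=> [:: [::]]) (l := ls)
  (U := fun x => (2 + (\prod_(l <- ls x) (size l).+1) * (msr (ls x)).+1)%N)
  _ _ _ _ pl).
- by polyb.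
- move=> x l1 l2 E; rewrite -/(cart l2) msr_seqE leq_add2l.
  apply: leq_trans (msr_cart l2) _; apply: leq_mul; last first.
    by rewrite E !msr_seqE big_cat /=; lia.
  rewrite E big_cat /=; apply: (@leq_trans (\prod_(l <- l2) (size l).+1)).
    by elim: l2 {E} => [|l l2 IH]; rewrite ?big_nil // !big_cons leq_mul.
  rewrite leq_pmull // prodn_gt0 //.
- by rewrite /=; pt.
- by pt.
Qed.

Lemma enclen_pow2 k : (enclen (2 ^ k)%:R <= 2 * k + 5)%N.
Proof.
have -> : (2 * k + 5 = 2 * k.+1 + 3)%N by lia.
apply: enclen_ht; rewrite -[(2 ^ k)%:R]/((2 ^ k)%N%:~R) ht_int /=.
by rewrite expnS; have := expn_gt0 2 k; lia.
Qed.

(** These are the powers of two up to [x]: [up_log 2 t.+1] counts the powers of two that are at most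
    t. *)
Definition pows (x : rat) : seq rat :=
  [seq (2 ^ k)%:R | k <- iota 0 (up_log 2 (Num.truncn x).+1)].

Lemma pow2_le (x : rat) k :
  ((2 ^ k)%:R <= x) = (k < up_log 2 (Num.truncn x).+1)%N.
Proof.
have -> : ((2 ^ k)%:R <= x) = (2 ^ k <= Num.truncn x)%N.
  by rewrite -[in RHS](prednK (expn_gt0 2 k)) truncn_gt_nat prednK ?expn_gt0.
apply/idP/idP => [kx|].
  rewrite ltnNge; apply/negP => /(leq_pexp2l (isT : 0 < 2)%N) xk.
  by have := up_logP (Num.truncn x).+1 (ltnSn 1); lia.
move=> kx; rewrite leqNgt; apply/negP => xk.
by have := up_log_min (ltnSn 1) xk; lia.
Qed.

Lemma truncn_numq (x : rat) : (Num.truncn x <= `|numq x|)%N.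
Proof.
have [x0|x0] := lerP 0 x; last first.
  by rewrite (_ : Num.truncn x = 0%N) //; apply/truncn0Pn; rewrite -ltNge; lra.
have := truncn_le x; rewrite x0 => tx.
rewrite -(ler_nat rat); apply: le_trans tx _.
rewrite pmulrn gez0_abs ?numq_ge0 // numqE.
by rewrite ler_peMr // -[1]/(1%:~R) ler_int; have := denq_gt0 x; lia.
Qed.

(** There is no list to fold over, so the recursion is explicit: from [(p, x)] it emits [p] and
    continues with [(p + p, x)] as long as [p <= x]. *)
Lemma PT_pows G {dG : data G} (f : G -> rat) : PT f -> PT (fun x => pows (f x)).
Proof.
pose V := EVar 0; pose p := EFst V.
pose body := EIf (EBin OLe p (ESnd V))
  (EPair p (ECall 0 (EPair (EBin OAdd p p) (ESnd V)))) (EConst 0).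
have evV (v : Defs.val) : Defs.eval [:: body] [:: v] V v (vsize v).
  exact: (@ev_var [:: body] [:: v] 0).
pose K (x : rat) := up_log 2 (Num.truncn x).+1.
(* Each argument [(p, x)] of the recursion has size at most [c x]. *)
pose c (x : rat) := (2 * K x + enclen x + 7)%N.
pose W (x : rat) := (20 * c x + 8 * c x ^ 2 + 20)%N.
have main (x : rat) j k : K x = (k + j)%N ->
    exists2 t, (t <= j.+1 * W x)%N
    & Defs.eval [:: body] [:: VPair (VNum (2 ^ k)%:R) (VNum x)] body
       (enc [seq (2 ^ k)%:R : rat | k <- iota k j]) t.
  elim: j k => [|j IH] k E; set v := VPair _ _; set s := vsize v.
  1-2: have ek := enclen_pow2 k; set e := enclen (2 ^ k)%:R in ek.
  1-2: have ec : (e + enclen x + 1 <= c x)%N by rewrite /c; lia.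
  1-2: have sE : s = (1 + e + enclen x)%N by [].
  1-2: have evp : Defs.eval [:: body] [:: v] p (VNum (2 ^ k)%:R) s.+1
    by exact: (ev_fst (v2 := VNum x) (evV v)).
  1-2: have evx : Defs.eval [:: body] [:: v] (ESnd V) (VNum x) s.+1
    by exact: (ev_snd (v1 := VNum (2 ^ k)%:R) (evV v)).
  1-2: have := ev_bin OLe evp evx; rewrite /bin_sem pow2_le -/(K x) -/e E.
    rewrite addn0 ltnn => evc.
    exists ((s.+1 + s.+1 + (e + enclen x) ^ 2) + 2).+1.
      by rewrite /W; nia.
    by apply: (ev_if_false _ evc); exact: ev_const.
  rewrite -[X in (X < _)%N]addn0 ltn_add2l => evc.
  have [|t tW ev] := IH k.+1; first by rewrite E addnS.
  exists ((s.+1 + s.+1 + (e + enclen x) ^ 2) +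
    (s.+1 + ((((s.+1 + s.+1 + (e + e) ^ 2) + s.+1).+1 + t).+1)).+1).+1.
    by rewrite mulSn /W in tW *; nia.
  apply: (ev_if_true _ evc) => //; apply: ev_pair => //.
  apply: (ev_call (v := VPair (VNum (2 ^ k.+1)%:R) (VNum x))) => //.
  apply: ev_pair => //; have := ev_bin OAdd evp evp.
  by rewrite /bin_sem -natrD addnn -mul2n -expnS.
apply: (@PT_comp _ _ _ _ _ _ pows).
exists [:: body], (ECall 0 (EPair (EConst 1) (EVar 0))),
  (fun x => ((enclen 1 + enclen x).+1 + (K x).+1 * W x).+1).
have KE : forall x, (K x <= enclen x)%N.
  move=> x; rewrite /K /enclen -add1n.
  apply: leq_trans (leq_up_log 2 (leq_add (leqnn 1) (truncn_numq x))) _.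
  by rewrite addnAC leq_addl.
have pK : polyb K by apply: polyb_le polyb_msr => x; exact: KE.
split.
- move=> x; have [t tW ev] := main x (K x) 0 (esym (add0n _)).
  exists ((enclen 1 + enclen x).+1 + t).+1; first by rewrite ltnS leq_add2l.
  apply: (ev_call (v := VPair (VNum 1) (VNum x))) => //.
  by apply: ev_pair; [exact: ev_const | exact: (@ev_var _ [:: VNum x] 0)].
- have pe : polyb enclen by exact: polyb_msr.
  by rewrite /W /c; polyb.
- apply: (@polyb_le _ _ _ (fun x => 2 + K x * (2 * K x + 6))%N); last by polyb.
  move=> x; rewrite msr_seqE leq_add2l /pows -/(K x) big_map.
  rewrite -[X in (_ <= X * _)%N](size_iota 0).
  apply: leq_sum_split => l1 k l2 lE.
  have : (k \in iota 0 (K x))%N by rewrite lE mem_cat mem_head orbT.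
  rewrite mem_iota => kK.
  pose proof (enclen_pow2 k : (msr ((2 ^ k)%:R : rat) <= _)%N).
  by lia.
Qed.

(** * The algorithm *)

Notation letter := (seq rat * (rat * rat))%type (only parsing).

(* When sg lists all words of n indices, this is the determinant of M times a
   nonzero Vandermonde determinant: the products of differences replace the
   signs of the permutations and vanish on the other words. *)
Definition delta (sg M : seq (seq rat)) : rat :=
  \sum_(s <- sg)
    (\prod_(p <- tag s) \prod_(q <- tag s) (if q.1 <= p.1 then 1 else q.2 - p.2))
    * \prod_(p <- tag M) nthr p.2 (nthr s p.1).

Definition repl (M : seq (seq rat)) (j : rat) (a : seq rat) : seq (seq rat) :=
  [seq if p.1 == j then a else p.2 | p : rat * seq rat <- tag M].

(* By Cramer's rule, the coefficient of the j-th row of M in the expansion of a;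
   the Vandermonde factors cancel. *)
Definition coef (sg M : seq (seq rat)) (j : rat) (a : seq rat) : rat :=
  delta sg (repl M j a) / delta sg M.

(** For intervals [l, u] with l <= u, the sum is the maximum of a row of A over the box with the
    center of C and three times its widths. This box is C + D, and also C - D because D is
    symmetric, so one test covers both inclusions. *)
Definition good (sg : seq (seq rat)) (pr : seq (seq rat * rat))
    (w : seq letter) : bool :=
  ~~ (delta sg [seq l.1 | l : letter <- w] == 0) &&
  all (fun p : seq rat * rat =>
    \sum_(q <- tag w)
      (coef sg [seq l.1 | l : letter <- w] q.1 p.1
         * ((q.2.2.1 + q.2.2.2) * 2^-1) +
       `|coef sg [seq l.1 | l : letter <- w] q.1 p.1|
         * ((q.2.2.2 - q.2.2.1) * (3 * 2^-1)))
    <= p.2) pr.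

(** The entry 1 is [crel_code CLe]. *)
Definition cellL (w : seq letter) : seq (seq rat * (rat * rat)) :=
  flatten [seq [:: ([seq - a | a : rat <- l.1], (1, - l.2.1)); (l.1, (1, l.2.2))]
          | l : letter <- w].

Definition dispL (w : seq letter) : seq (seq rat * (rat * rat)) :=
  cellL [seq (l.1, (- (l.2.2 - l.2.1), l.2.2 - l.2.1)) | l : letter <- w].

Definition input : Type := ((rat * rat) * (seq (seq rat) * seq rat))%type.

Section Algorithm.
Variable x : input.

(** It serves as a list of length n to loop over, in place of a counter; likewise [row0 ++ row0] for
    2n. *)
Definition row0 : seq rat := head [::] x.2.1.

Definition prow : seq (seq rat * rat) :=
  [seq (p.2, nthr x.2.2 p.1) | p : rat * seq rat <- tag x.2.1].

(** A common denominator of a row and its right side: multiplied by it, the slack of an integer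
    point is an integer. *)
Definition qden (p : seq rat * rat) : rat :=
  (denq p.2)%:~R * \prod_(a <- p.1) (denq a)%:~R.

Definition bigM : rat :=
  maxs (flatten [seq [seq qden p * `|a| | a : rat <- p.2 :: p.1]
                | p : seq rat * rat <- prow]).

(** This is (n (M + 1))^(n + 1), with one factor per entry of [0 :: row0]; it bounds every scaled
    slack by [slack_bound]. *)
Definition bnd : rat := \prod_(a <- 0 :: row0) (x.1.2 * (bigM + 1)).

(* Rows with an interval [b - (1 + (s+1)/2n) e/q, b - (1 + s/2n) e/q] for the
   value of the row, that is, with the slack in a dyadic interval that is
   divided into 2n parts; the degenerate interval stands for slack 0. *)
Definition letters : seq letter :=
  flatten [seq (p.1, (p.2, p.2)) ::
    flatten [seq
      [seq (p.1,
         (p.2 - e * (qden p)^-1 * (1 + (s + 1) * (2 * x.1.2)^-1),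
          p.2 - e * (qden p)^-1 * (1 + s * (2 * x.1.2)^-1)))
      | s : rat <- idx (row0 ++ row0)] | e : rat <- pows bnd]
    | p : seq rat * rat <- prow].

Definition candidates : seq (seq letter) := cart [seq letters | _ <- row0].

Definition signs : seq (seq rat) := cart [seq idx row0 | _ <- row0].

Definition coverL : seq (seq (seq rat * (rat * rat)) * seq (seq rat * (rat * rat)))
  := flatten [seq if good signs prow w then [:: (cellL w, dispL w)] else [::]
             | w : seq letter <- candidates].

End Algorithm.

Ltac pt_fun ::=
  lazymatch goal with
  | |- PT (fun x => tag (@?f x)) => apply: (PT_tag (l := f)); pt
  | |- PT (fun x => idx (@?f x)) => apply: (PT_idx (l := f)); pt
  | |- PT (fun x => nthr (@?f x) (@?g x)) =>
      apply: (PT_nthr (l := f) (k := g)); pt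
  | |- PT (fun x => maxs (@?f x)) => apply: (PT_maxs (l := f)); pt
  | |- PT (fun x => head (@?g x) (@?f x)) =>
      apply: (PT_head (d := g) (l := f)); pt
  | |- PT (fun x => pows (@?f x)) => apply: (PT_pows (f := f)); pt
  | |- PT (fun x => delta (@?f x) (@?g x)) => rewrite /delta; pt
  | |- PT (fun x => repl (@?f x) (@?g x) (@?h x)) => rewrite /repl; pt
  | |- PT (fun x => coef (@?f x) (@?g x) (@?j x) (@?a x)) => rewrite /coef; pt
  | |- PT (fun x => good (@?f x) (@?g x) (@?w x)) => rewrite /good; pt
  | |- PT (fun x => cellL (@?f x)) => rewrite /cellL; pt
  | |- PT (fun x => dispL (@?f x)) => rewrite /dispL; pt
  | |- PT (fun x => row0 (@?f x)) => rewrite /row0; pt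
  | |- PT (fun x => prow (@?f x)) => rewrite /prow; pt
  | |- PT (fun x => qden (@?f x)) => rewrite /qden; pt
  | |- PT (fun x => bnd (@?f x)) => rewrite /bnd /bigM; pt
  | |- PT (fun x => letters (@?f x)) => rewrite /letters; pt
  end.

Lemma PT_coverL G {dG : data G} (f : G -> input) : PT f ->
  polyb (fun x => (size (letters (f x))).+1 ^ size (row0 (f x)))%N ->
  polyb (fun x => (size (row0 (f x))).+1 ^ size (row0 (f x)))%N ->
  PT (fun x => coverL (f x)).
Proof.
move=> pf p1 p2.
have E A (l : seq A) (s : seq rat) :
    (\prod_(t <- [seq l | _ <- s]) (size t).+1 = (size l).+1 ^ size s)%N.
  by rewrite big_map big_const_seq count_predT iter_muln_1.
assert (ps : PT (fun x => signs (f x))).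
  rewrite /signs; apply: PT_cart; last by pt.
  by apply: polyb_le p2 => x; rewrite E size_map size_tag.
assert (pc : PT (fun x => candidates (f x))).
  rewrite /candidates; apply: PT_cart; last by pt.
  by apply: polyb_le p1 => x; rewrite E.
(* The enumerated lists enter as data, so the bounds on their number of words are used only where
   they are built. *)
apply: (@PT_comp _ _ _ _ _ _
  (fun z : seq (seq rat) * seq (seq rat * rat) * seq (seq letter) =>
    flatten [seq if good z.1.1 z.1.2 w then [:: (cellL w, dispL w)] else [::]
            | w : seq letter <- z.2])
  (fun x => (signs (f x), prow (f x), candidates (f x)))); first by pt.
by apply: PT_pair => //; pt.
Qed.

(** * Bases that dominate all slacks *)

Section Basis.
Variables (F : realFieldType) (m n : nat) (A : 'M[F]_(m, n)).
Implicit Types (f g : {ffun 'I_n -> 'I_m}).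

Definition subst_row f (j : 'I_n) (i : 'I_m) : {ffun 'I_n -> 'I_m} :=
  [ffun k => if k == j then i else f k].

(** The substituted matrix is M B, where M is the identity with row [j] replaced by the coefficients
    of row [i] in the basis B; the determinant of M is its diagonal entry in row [j]. *)
Lemma det_subst_row f j i : rowsub f A \in unitmx ->
  \det (rowsub (subst_row f j i) A) =
  (A *m invmx (rowsub f A)) i j * \det (rowsub f A).
Proof.
move=> uf; set B := rowsub f A; set c := A *m invmx B.
have cB : c *m B = A by rewrite mulmxKV.
move: c cB => c cB.
pose M := \matrix_(k, l) (if k == j then c i l else (k == l)%:R) : 'M_n.
have -> : rowsub (subst_row f j i) A = M *m B.
  apply/matrixP => k p; rewrite !mxE ffunE.
  have [->|kj] := eqVneq k j.
    rewrite -[in LHS]cB mxE; apply: eq_bigr => l _; congr (_ * _).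
    by rewrite mxE eqxx.
  rewrite (bigD1 k) //= big1 ?addr0 => [|l lk].
    by rewrite !mxE (negbTE kj) eqxx mul1r.
  by rewrite [M k l]mxE (negbTE kj) eq_sym (negbTE lk) mul0r.
rewrite det_mulmx; congr (_ * _).
(* A cofactor along row [j] ignores that row, hence agrees with the one of the identity. *)
have cofE l : cofactor M j l = (l == j)%:R.
  transitivity (cofactor (1%:M : 'M[F]_n) j l).
    rewrite /cofactor; congr (_ * \det _); apply/matrixP => k p.
    by rewrite !mxE eq_sym (negbTE (neq_lift _ _)).
  transitivity ((\adj (1%:M : 'M[F]_n)) l j); first by rewrite [in RHS]mxE.
  by rewrite adj1 mxE.
rewrite (expand_det_row M j) (bigD1 j) //= big1 ?addr0 => [|l lj].
  by rewrite cofE mxE !eqxx mulr1.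
by rewrite cofE (negbTE lj) mulr0.
Qed.

(* Maximize the number of rows with slack 0, and then |det| divided by the
   product of the other slacks: exchanging row f j for row i multiplies the
   determinant by the coefficient. *)
Lemma dominating_basis (s : 'I_m -> F) : row_full A -> (forall i, 0 <= s i) ->
  exists2 f : {ffun 'I_n -> 'I_m}, rowsub f A \in unitmx &
    forall i j, `|(A *m invmx (rowsub f A)) i j| * s (f j) <= s i.
Proof.
move=> rA s0; pose U f := rowsub f A \in unitmx.
have [f0 U0] : exists f, U f.
  by exists (fullrankfun rA); rewrite /U fullrowsub_unit.
pose T f := (\sum_j (s (f j) == 0%R))%N.
have [f1 U1 max1] := arg_maxnP T U0.
pose h r : F := if r == 0 then 1 else r^-1.
pose V f := `|\det (rowsub f A)| * \prod_j h (s (f j)).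
pose U' f := U f && (T f == T f1).
have U1' : U' f1 by rewrite /U' U1 eqxx.
have [f /andP[Uf /eqP Tf] maxf] := Order.TotalTheory.arg_maxP V U1'.
exists f => // i j.
set c := _ i j; have [->|c0] := eqVneq c 0; first by rewrite normr0 mul0r.
have [->|sj0] := eqVneq (s (f j)) 0; first by rewrite mulr0.
have sj : 0 < s (f j) by rewrite lt_def sj0 s0.
pose g := subst_row f j i.
have dg := det_subst_row j i Uf; rewrite -/c -/g in dg.
have df : \det (rowsub f A) != 0 by rewrite -unitfE -unitmxE.
have Ug : U g by rewrite /U unitmxE unitfE dg mulf_neq0.
have gk k : k != j -> g k = f k by move=> kj; rewrite ffunE (negbTE kj).
have gj : g j = i by rewrite ffunE eqxx.
have Tg : T g = (T f + (s i == 0%R))%N.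
  rewrite /T (bigD1 j) //= [in RHS](bigD1 j) //= gj (negbTE sj0) add0n addnC.
  by congr (_ + _)%N; apply: eq_bigr => k kj; rewrite gk.
(* A zero slack of row [i] would give [g] more tight rows than [f], against [max1]. *)
have si0 : s i != 0.
  apply/negP => si0; have := max1 g Ug; rewrite Tg Tf si0 /=; lia.
have si : 0 < s i by rewrite lt_def si0 s0.
have := maxf g; rewrite /U' Ug Tg Tf (negbTE si0) addn0 eqxx => /(_ isT).
rewrite /V dg normrM [\prod_(k < n) h (s (g k))](bigD1 j) //=.
rewrite [\prod_(k < n) h (s (f k))](bigD1 j) //= gj.
have -> : h (s i) = (s i)^-1 by rewrite /h (negbTE si0).
have -> : h (s (f j)) = (s (f j))^-1 by rewrite /h (negbTE sj0).
under eq_bigr => k kj do rewrite gk //.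
set p := \prod_(_ | _) _; have p0 : 0 < p.
  apply: prodr_gt0 => k _; rewrite /h; case: eqP => // /eqP sk0.
  by rewrite invr_gt0 lt_def sk0 s0.
have dp : 0 < `|\det (rowsub f A)| by rewrite normr_gt0.
have -> : `|c| * `|\det (rowsub f A)| * ((s i)^-1 * p) =
  (`|c| / s i) * (`|\det (rowsub f A)| * p) by ring.
have -> : `|\det (rowsub f A)| * ((s (f j))^-1 * p) =
  (s (f j))^-1 * (`|\det (rowsub f A)| * p) by ring.
rewrite ler_pM2r ?mulr_gt0 // ler_pdivrMr // mulrC -ler_pdivrMr ?invr_gt0 //.
by rewrite invrK.
Qed.

End Basis.

(** * Vertices *)

Section Vertex.
Variables (F : realFieldType) (m n : nat) (A : 'M[F]_(m, n)) (b : 'cV[F]_m).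
Implicit Types (x v : 'cV[F]_n).

(* As long as the tight rows do not have full rank, move along a direction that
   they do not see, and that does not decrease g, until another row is tight. *)
Lemma vertex_above (g : 'rV[F]_n) x :
  (forall v, (forall i, (A *m v) i 0 <= 0) -> v = 0) ->
  (forall i, (A *m x) i 0 <= b i 0) ->
  exists (f : 'I_n -> 'I_m) (y : 'cV[F]_n),
    [/\ rowsub f A \in unitmx, rowsub f A *m y = rowsub f b
      & (g *m x) 0 0 <= (g *m y) 0 0].
Proof.
move=> ray.
pose t x i := (A *m x) i 0 == b i 0.
pose At x := \matrix_(i, j) (if t x i then A i j else 0) : 'M[F]_(m, n).
(* Induction on the rank that the tight rows lack. *)
have [k] := ubnP (n - \rank (At x)); elim: k x => // k IH x kx hx.
have [rx|rx] := boolP (row_full (At x)).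
  pose f := fullrankfun rx; have uf : rowsub f (At x) \in unitmx.
    exact: fullrowsub_unit.
  have tf j : t x (f j).
    apply: contraT => /negbTE ntf.
    have := congr1 (fun M : 'M_n => M j j) (mulmxV uf).
    rewrite !mxE eqxx big1 => [/esym/eqP|l _]; first by rewrite oner_eq0.
    by rewrite !mxE ntf mul0r.
  have fE : rowsub f (At x) = rowsub f A.
    by apply/matrixP => j l; rewrite !mxE tf.
  exists f, x; split=> //; first by rewrite -fE.
  apply/colP => j; have /eqP := tf j; rewrite !mxE => <-.
  by apply: eq_bigr => l _; rewrite mxE.
have [v v0 Av] : exists2 v : 'cV[F]_n, v != 0 & At x *m v = 0.
  have : cokermx (At x) != 0.
    rewrite -mxrank_eq0 mxrank_coker subn_eq0 -ltnNge ltn_neqAle.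
    by rewrite rank_leq_col andbT.
  case/matrix0Pn => i [j ij]; exists (col j (cokermx (At x))).
    by apply/matrix0Pn; exists i, 0; rewrite mxE.
  by rewrite colE mulmxA mulmx_coker mul0mx.
(* The tight rows vanish on [- v] as well, so the sign is free. *)
wlog gv : v v0 Av / 0 <= (g *m v) 0 0.
  move=> H; have [|/ltW gv] := lerP 0 ((g *m v) 0 0); first exact: H.
  apply: (H (- v)); rewrite ?oppr_eq0 // ?mulmxN ?Av ?oppr0 //.
  by rewrite mxE oppr_ge0.
have tight i : t x i -> (A *m v) i 0 = 0.
  move=> ti; transitivity ((At x *m v) i 0); last by rewrite Av mxE.
  by rewrite !mxE; apply: eq_bigr => l _; rewrite !mxE ti.
have [i0 Avi0] : exists i, 0 < (A *m v) i 0.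
  apply/existsP; apply: contraT; rewrite negb_exists => /forallP H.
  by rewrite (ray v) ?eqxx // in v0 => i; rewrite leNgt H.
(* Ratio test: the longest feasible step along [v] ends at the row with the least ratio, which
   becomes tight. *)
pose r i := (b i 0 - (A *m x) i 0) / (A *m v) i 0.
have [i Avi mini] :=
  @Order.TotalTheory.arg_minP _ _ _ i0 (fun i => 0 < (A *m v) i 0) r Avi0.
pose y := x + r i *: v.
have Ay l : (A *m y) l 0 = (A *m x) l 0 + r i * (A *m v) l 0.
  by rewrite /y mulmxDr -scalemxAr !mxE.
have r0 : 0 <= r i by rewrite divr_ge0 ?subr_ge0 // ltW.
have hy l : (A *m y) l 0 <= b l 0.
  rewrite Ay; have [vl|vl] := lerP ((A *m v) l 0) 0.
    have := hx l; have : r i * (A *m v) l 0 <= 0 by rewrite mulr_ge0_le0.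
    lra.
  by have := mini l vl; rewrite {2}/r ler_pdivlMr //; lra.
have ty l : t x l -> t y l.
  by move=> tl; rewrite /t Ay tight // mulr0 addr0.
have tyi : t y i.
  by rewrite /t Ay /r divfK ?lt0r_neq0 // addrC subrK.
(* The old tight rows vanish on [v] and the new one does not, so the row space grows strictly. *)
have lt : (At x < At y)%MS.
  apply/andP; split.
    apply/row_subP => l; have [tl|/negbTE ntl] := boolP (t x l).
      have -> : row l (At x) = row l (At y).
        by apply/rowP => p; rewrite !mxE tl ty.
      exact: row_sub.
    rewrite (_ : row l _ = 0) ?sub0mx //; apply/rowP => p.
    by rewrite !mxE ntl.
  apply/negP => /submxP[D Dy].
  have : (At y *m v) i 0 = 0 by rewrite Dy -mulmxA Av mulmx0 mxE.
  have -> : (At y *m v) i 0 = (A *m v) i 0.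
    by rewrite !mxE; apply: eq_bigr => l _; rewrite !mxE tyi.
  by move=> E; rewrite E ltxx in Avi.
have rk := rank_ltmx lt.
have [|f [z [uf fz gz]]] := IH y _ hy.
  by have := rank_leq_col (At y); lia.
exists f, z; split=> //; apply: le_trans gz.
by rewrite /y mulmxDr -scalemxAr !mxE lerDl mulr_ge0 //; move: gv; rewrite mxE.
Qed.

End Vertex.

Lemma factS_le n : (n.+1`! <= n.+1 ^ n)%N.
Proof.
elim: n => // n IH; rewrite factS expnS leq_mul2l.
by apply: leq_trans IH _; rewrite leq_exp2r_w.
Qed.

(** The determinant is a nonzero integer, so dividing by it cannot enlarge [\det B * y l 0], which
    the cofactors bound. *)
Lemma cramer_bound n (B : 'M[rat]_n) (d y : 'cV[rat]_n) (M : rat) :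
  B \in unitmx -> B *m y = d -> (forall i j, B i j \is a Num.int) ->
  (forall i j, `|B i j| <= M) -> (forall i, `|d i 0| <= M) ->
  forall l, `|y l 0| <= (n%:R * M) ^+ n.
Proof.
case: n B d y => [B d y _ _ _ _ _ []|n B d y] // uB By Bint BM dM l.
have M0 : 0 <= M by apply: le_trans (dM l).
have det1 : 1 <= `|\det B|.
  have di : \det B \is a Num.int.
    rewrite /determinant; apply: rpred_sum => s _.
    by rewrite rpredMsign; apply: rpred_prod.
  by apply: norm_intr_ge1 => //; rewrite -unitfE -unitmxE.
(* Only permutations that send [i] to [l] contribute, but all of them are counted; [factS_le] makes
   up for this. *)
have cof i : `|cofactor B i l| <= n.+1`!%:R * M ^+ n.
  rewrite expand_cofactor; apply: le_trans (ler_norm_sum _ _ _) _.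
  rewrite -card_Sn -sum1_card natr_sum mulr_suml.
  rewrite [leRHS](bigID (fun s : 'S_n.+1 => s i == l)) /=.
  rewrite -[leLHS]addr0; apply: lerD; last first.
    by apply: sumr_ge0 => s _; rewrite mul1r exprn_ge0.
  apply: ler_sum => s _; rewrite normrM normrX normrN1 expr1n !mul1r normr_prod.
  have -> : M ^+ n = \prod_(k | i != k) M.
    rewrite prodr_const (eq_card (B := predC1 i)) ?cardC1 ?card_ord // => k.
    by rewrite !inE eq_sym.
  by apply: ler_prod => k _; rewrite normr_ge0 BM.
have E : \det B * y l 0 = \sum_i cofactor B i l * d i 0.
  have := congr1 (fun v : 'cV_n.+1 => v l 0) (congr1 (mulmx (\adj B)) By).
  rewrite mulmxA mul_adj_mx mul_scalar_mx !mxE => ->.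
  by apply: eq_bigr => i _; rewrite mxE.
have : `|\det B| * `|y l 0| <= (n.+1 * n.+1`!)%:R * M ^+ n.+1.
  rewrite -normrM E; apply: le_trans (ler_norm_sum _ _ _) _.
  rewrite natrM -mulrA mulr_natl -[X in _ *+ X]card_ord -sumr_const.
  apply: ler_sum => i _; rewrite normrM exprSr mulrA.
  by apply: ler_pM => //; rewrite normr_ge0.
move=> H; apply: le_trans (le_trans H _).
  by rewrite ler_peMl.
rewrite exprMn ler_wpM2r ?exprn_ge0 // -natrX ler_nat expnS leq_mul2l.
exact: factS_le.
Qed.

(** * Sizes of the scaled system *)

Lemma enclen_ge2 r : (2 <= enclen r)%N.
Proof.
have : (0 < up_log 2 (1 + `|denq r|))%N.
  by rewrite up_log_gt0 /= add1n ltnS denq_absz_gt0.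
by rewrite /enclen; lia.
Qed.

(** A nonzero numerator takes at least one bit besides the constant 1 in [enclen], and with
    numerator 0 the denominator is 1. The exponent [e - 2] instead of [e] is what makes the count in
    [letter_count] fit for n = 1. *)
Lemma denq_le_enclen (r : rat) e : (enclen r <= e)%N ->
  (denq r)%:~R <= 2 ^+ (e - 2) :> rat.
Proof.
move=> re; have -> : (denq r)%:~R = (`|denq r|%N)%:R :> rat.
  by rewrite pmulrn absz_denq.
rewrite -natrX ler_nat.
have := up_logP (1 + `|denq r|) (ltnSn 1).
have [/eqP r0|r0] := eqVneq (numq r) 0.
  by rewrite numq_eq0 in r0; rewrite (eqP r0) expn_gt0.
have : (0 < up_log 2 (1 + `|numq r|))%N.
  by rewrite up_log_gt0 /= add1n ltnS absz_gt0.
rewrite /enclen in re => h1 h2; have le : (up_log 2 (1 + `|denq r|) <= e - 2)%N.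
  by lia.
have := leq_pexp2l (isT : 0 < 2)%N le; lia.
Qed.

(** The + 1 is carried through [scaled_le] into the bound for [bigM x + 1]. *)
Lemma numq_le_enclen (r : rat) e : (enclen r <= e)%N ->
  `|r| * (denq r)%:~R + 1 <= 2 ^+ (e - 2) :> rat.
Proof.
move=> re; have -> : `|r| * (denq r)%:~R = (`|numq r|%N)%:R :> rat.
  rewrite -[(denq r)%:~R]ger0_norm ?ler0z ?denq_ge0 // -normrM -numqE.
  by rewrite pmulrn abszE intr_norm.
rewrite -natrX natr1 ler_nat.
have := up_logP (1 + `|numq r|) (ltnSn 1).
have : (0 < up_log 2 (1 + `|denq r|))%N.
  by rewrite up_log_gt0 /= add1n ltnS denq_absz_gt0.
rewrite /enclen in re => h1 h2; have le : (up_log 2 (1 + `|numq r|) <= e - 2)%N.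
  by lia.
have := leq_pexp2l (isT : 0 < 2)%N le; lia.
Qed.

Section Scaled.
Variables (m n : nat) (A : 'M[rat]_(m, n)) (b : 'cV[rat]_m).
Local Notation L := (enclen_sys_max A b).

Definition qd (i : 'I_m) : rat :=
  (denq (b i 0))%:~R * \prod_(j < n) (denq (A i j))%:~R.

Lemma enclen_sys_maxA i j : (enclen (A i j) <= L)%N.
Proof.
rewrite /enclen_sys_max; apply: leq_trans (leq_maxr _ _).
apply: leq_trans (leq_maxl _ _); rewrite /mx_enclen_max.
apply: leq_trans (leq_bigmax i).
exact: (leq_bigmax (F := fun j => enclen (A i j))).
Qed.

Lemma enclen_sys_maxb i : (enclen (b i 0%R) <= L)%N.
Proof.
rewrite /enclen_sys_max; apply: leq_trans (leq_maxr _ _).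
apply: leq_trans (leq_maxr _ _); rewrite /mx_enclen_max.
apply: leq_trans (leq_bigmax i).
exact: (leq_bigmax (F := fun j => enclen (b i j))).
Qed.

Lemma denq_gt0r (r : rat) : 0 < (denq r)%:~R :> rat.
Proof. by rewrite ltr0z denq_gt0. Qed.

Lemma qd_gt0 i : 0 < qd i.
Proof. by rewrite mulr_gt0 ?denq_gt0r ?prodr_gt0 // => j _; exact: denq_gt0r. Qed.

Lemma qdA i j : qd i * A i j = (denq (b i 0))%:~R *
  ((numq (A i j))%:~R * \prod_(k < n | k != j) (denq (A i k))%:~R).
Proof. by rewrite /qd (bigD1 j) //= numqE; ring. Qed.

Lemma qdb i : qd i * b i 0 = (numq (b i 0))%:~R * \prod_j (denq (A i j))%:~R.
Proof. by rewrite /qd numqE; ring. Qed.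

Lemma qdA_int i j : qd i * A i j \is a Num.int.
Proof.
by rewrite qdA !rpredM ?rpred_int ?rpred_prod // => k _; exact: rpred_int.
Qed.

Lemma qdb_int i : qd i * b i 0 \is a Num.int.
Proof.
by rewrite qdb !rpredM ?rpred_int ?rpred_prod // => k _; exact: rpred_int.
Qed.

Lemma prod_denq_le (P : pred 'I_n) i :
  \prod_(k < n | P k) (denq (A i k))%:~R <= (2 ^+ (L - 2)) ^+ #|P| :> rat.
Proof.
rewrite -prodr_const; apply: ler_prod => k _.
by rewrite ltW ?denq_gt0r // denq_le_enclen ?enclen_sys_maxA.
Qed.

Lemma scaled_le (c d N : rat) k : 0 <= d -> 0 <= c -> 1 <= N ->
  c + 1 <= N -> d <= N ^+ k -> c * d + 1 <= N ^+ k.+1.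
Proof.
move=> d0 c0 N1 cN dN; rewrite exprS.
have Nk : 1 <= N ^+ k by rewrite exprn_ege1.
have : c * d <= c * N ^+ k by rewrite ler_wpM2l.
have : (c + 1) * N ^+ k <= N * N ^+ k by rewrite ler_wpM2r //; lra.
by rewrite mulrDl mul1r; lra.
Qed.

Lemma pow2_ge1 k : 1 <= 2 ^+ k :> rat.
Proof. by rewrite exprn_ege1. Qed.

(** The denominator of the entry cancels. What remains is its numerator, the denominator of the
    right side and n - 1 other denominators: n + 1 factors, each at most 2^(L - 2). *)
Lemma qdA_le i j : qd i * `|A i j| + 1 <= (2 ^+ (L - 2)) ^+ n.+1.
Proof.
have -> : qd i * `|A i j| = (`|A i j| * (denq (A i j))%:~R) *
    ((denq (b i 0))%:~R * \prod_(k < n | k != j) (denq (A i k))%:~R).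
  by rewrite /qd (bigD1 j) //=; ring.
apply: scaled_le; rewrite ?pow2_ge1 ?numq_le_enclen ?enclen_sys_maxA //.
- by rewrite mulr_ge0 ?prodr_ge0 ?ltW ?denq_gt0r // => k _; rewrite ltW ?denq_gt0r.
- by rewrite mulr_ge0 // ltW ?denq_gt0r.
have nE : n = n.-1.+1 by rewrite (ltn_predK (ltn_ord j)).
rewrite [X in _ <= _ ^+ X]nE exprS; apply: ler_pM.
- by rewrite ltW ?denq_gt0r.
- by rewrite prodr_ge0 // => k _; rewrite ltW ?denq_gt0r.
- by rewrite denq_le_enclen ?enclen_sys_maxb.
apply: le_trans (prod_denq_le _ _) _.
by rewrite (eq_card (B := predC1 j)) ?cardC1 ?card_ord // => k; rewrite !inE.
Qed.

Lemma qdb_le i : qd i * `|b i 0| + 1 <= (2 ^+ (L - 2)) ^+ n.+1.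
Proof.
have -> : qd i * `|b i 0| = (`|b i 0| * (denq (b i 0))%:~R) *
    \prod_(k < n) (denq (A i k))%:~R by rewrite /qd; ring.
apply: scaled_le; rewrite ?pow2_ge1 ?numq_le_enclen ?enclen_sys_maxb //.
- by rewrite prodr_ge0 // => k _; rewrite ltW ?denq_gt0r.
- by rewrite mulr_ge0 // ltW ?denq_gt0r.
by apply: le_trans (prod_denq_le _ _) _; rewrite cardT size_enum_ord.
Qed.

Lemma qd_le i : qd i <= (2 ^+ (L - 2)) ^+ n.+1.
Proof.
rewrite exprS; apply: ler_pM.
- by rewrite ltW ?denq_gt0r.
- by rewrite prodr_ge0 // => k _; rewrite ltW ?denq_gt0r.
- by rewrite denq_le_enclen ?enclen_sys_maxb.
by apply: le_trans (prod_denq_le _ _) _; rewrite cardT size_enum_ord.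
Qed.

Lemma qd_ht i : (ht (qd i) <= 2 ^ ((L * n.+1).+1))%N.
Proof.
have qn : qd i \is a Num.int.
  by rewrite rpredM ?rpred_int ?rpred_prod // => k _; exact: rpred_int.
case/intrP: qn => z qz; rewrite qz ht_int.
have z0 : 0 <= z by rewrite -(ler0z rat) -qz ltW ?qd_gt0.
have : (`|z|%N)%:R <= (2 ^+ L) ^+ n.+1 :> rat.
  rewrite pmulrn gez0_abs // -qz; apply: le_trans (qd_le i) _.
  by rewrite lerXn2r ?nnegrE ?exprn_ge0 // ler_weXn2l ?ler1n // leq_subr.
rewrite -exprM -natrX ler_nat expnS => zl.
by have := expn_gt0 2 (L * n.+1); lia.
Qed.

Lemma slack_bound (M : rat) (x : 'cV[rat]_n) j : (0 < n)%N ->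
  (forall v : 'cV[rat]_n, (forall i, (A *m v) i 0 <= 0) -> v = 0) ->
  (forall i, (A *m x) i 0 <= b i 0) ->
  (forall i k, qd i * `|A i k| <= M) -> (forall i, qd i * `|b i 0| <= M) ->
  qd j * (b j 0 - (A *m x) j 0) <= (n%:R * (M + 1)) ^+ n.+1.
Proof.
move=> n0 ray hx AM bM.
have [f [y [uf fy gy]]] := vertex_above (- row j A) ray hx.
have M0 : 0 <= M by apply: le_trans (bM j); rewrite mulr_ge0 // ltW ?qd_gt0.
pose q := \row_k qd (f k).
have yM l : `|y l 0| <= (n%:R * M) ^+ n.
  apply: (cramer_bound (B := diag_mx q *m rowsub f A)
    (d := diag_mx q *m rowsub f b)).
  - rewrite unitmx_mul uf andbT unitmxE det_diag unitfE.
    by apply/prodf_neq0 => k _; rewrite mxE lt0r_neq0 ?qd_gt0.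
  - by rewrite -mulmxA fy.
  - by move=> i k; rewrite mul_diag_mx !mxE qdA_int.
  - by move=> i k; rewrite mul_diag_mx !mxE normrM gtr0_norm ?qd_gt0.
  - by move=> i; rewrite mul_diag_mx !mxE normrM gtr0_norm ?qd_gt0.
have Axy : - (A *m x) j 0 <= - (A *m y) j 0.
  by move: gy; rewrite !mulNmx -!row_mul !mxE.
apply: (@le_trans _ _ (qd j * `|b j 0| + \sum_l (qd j * `|A j l|) * `|y l 0|)).
  rewrite mulrBr; apply: lerD; first by rewrite ler_pM2l ?qd_gt0 ?ler_norm.
  apply: (@le_trans _ _ (qd j * - (A *m y) j 0)).
    by rewrite -mulrN ler_pM2l ?qd_gt0.
  rewrite mulrN mxE mulr_sumr -sumrN; apply: ler_sum => l _.
  by rewrite -mulrA -normrM -mulrN ler_pM2l ?qd_gt0 // -normrN ler_norm.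
apply: (@le_trans _ _ (M + (n%:R * M) ^+ n.+1)).
  apply: lerD => //; rewrite exprS -mulrA mulr_natl.
  rewrite -[X in _ *+ X]card_ord -sumr_const; apply: ler_sum => l _.
  by apply: ler_pM => //; rewrite mulr_ge0 // ltW ?qd_gt0.
(* It remains to bound M + u^(n + 1) by (u + n)^(n + 1). One factor u + n is split: u accounts for
   the power and n for M. *)
set u := n%:R * M.
have n1 : 1 <= n%:R :> rat by rewrite ler1n.
have u0 : 0 <= u by rewrite mulr_ge0.
have -> : n%:R * (M + 1) = u + n%:R by rewrite /u; ring.
have u1 : u + n%:R <= (u + n%:R) ^+ n.
  by case: n n0 n1 @u u0 => // k _ *; rewrite -[leLHS]expr1 ler_weXn2l //; lra.
have uu : u ^+ n <= (u + n%:R) ^+ n by rewrite lerXn2r ?nnegrE //; lra.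
have uM : M <= u by rewrite /u ler_peMl.
rewrite [in leRHS]exprS mulrDl addrC; apply: lerD.
  by rewrite exprS ler_wpM2l.
apply: (@le_trans _ _ (1 * (u + n%:R))); first by lra.
by apply: ler_pM => //; lra.
Qed.

End Scaled.

(** * Dyadic intervals *)

(** The integer t = q s is positive, so the largest power of two e up to t satisfies e <= t < 2 e.
    Then t / e - 1 lies in [0, 1), and k is the number of the part of length 1 / 2n that contains
    it. *)
Lemma slack_interval (n : nat) (q s B : rat) : (0 < n)%N -> 0 < q -> 0 < s ->
  q * s \is a Num.int -> q * s <= B ->
  exists e k, [/\ e \in pows B, (k < n + n)%N, e / q <= s,
    e / q * (1 + k%:R / (2 * n%:R)) <= s
    & s <= e / q * (1 + (k%:R + 1) / (2 * n%:R))].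
Proof.
move=> n0 q0 s0 qs qsB; have qs0 : 0 < q * s by rewrite mulr_gt0.
have [t qt] : exists t : nat, q * s = t%:R.
  case/intrP: qs qs0 => z ->; rewrite ltr0z => z0; exists `|z|%N.
  by rewrite pmulrn gtz0_abs.
have t0 : (0 < t)%N by rewrite -(ltr_nat rat) -qt.
pose k2 := trunc_log 2 t.
have lt : (2 ^ k2 <= t)%N by apply: trunc_logP.
have gt : (t < 2 ^ k2.+1)%N by apply: trunc_log_ltn.
pose e : rat := (2 ^ k2)%:R; have e0 : 0 < e by rewrite ltr0n expn_gt0.
have eB : e \in pows B.
  apply/mapP; exists k2 => //; rewrite mem_iota /= add0n -pow2_le.
  by apply: le_trans qsB; rewrite qt ler_nat.
have sE : s = e / q * (t%:R / e) by rewrite -qt; field; rewrite !lt0r_neq0.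
have te1 : 1 <= t%:R / e by rewrite ler_pdivlMr // mul1r ler_nat.
have te2 : t%:R / e < 2.
  by rewrite ltr_pdivrMr // /e -natrM ltr_nat -expnS.
have n20 : 0 < 2 * n%:R :> rat by rewrite mulr_gt0 ?ltr0n.
pose r := (t%:R / e - 1) * (2 * n%:R).
have r0 : 0 <= r by rewrite mulr_ge0 ?subr_ge0 // ltW.
have /andP[k1 k3] := truncn_itv r0.
have eq0 : 0 < e / q by rewrite divr_gt0.
exists e, (Num.truncn r); split=> //.
- rewrite truncn_lt_nat // natrD -mulr2n -[_ *+ 2]mulr_natl.
  by rewrite /r -[ltRHS]mul1r ltr_pM2r //; lra.
- by rewrite sE ler_peMr // ltW.
- rewrite [leRHS]sE ler_pM2l // -lerBrDl ler_pdivrMr //.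
- rewrite [leLHS]sE ler_pM2l // -lerBlDl ler_pdivlMr // natr1.
  exact: ltW.
Qed.

Lemma size_pows (B : rat) k : B <= 2 ^+ k -> (size (pows B) <= k.+1)%N.
Proof.
move=> Bk; rewrite size_map size_iota; apply: up_log_min => //.
have : (Num.truncn B <= 2 ^ k)%N.
  by rewrite truncn_le_nat (le_lt_trans Bk) // -natrX ltr_nat.
by rewrite expnS; have := expn_gt0 2 k; lia.
Qed.

(* For n = 1 the factor n ^ 6 is 1, so that no constant can be lost here. *)
Lemma letter_count (n L : nat) : (0 < n)%N -> (2 <= L)%N ->
  (1 + (n + n) * ((n.-1 + n.+1 * (L - 2)) * n.+1).+1 <= n ^ 6 * L.+1 ^ 2)%N.
Proof.
move=> n0 L2; have [->|n1] := eqVneq n 1%N.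
  have [k ->] : exists k, L = k.+2 by exists (L - 2)%N; lia.
  rewrite exp1n mul1n -mulnn subSS subSS subn0; nia.
have h1 : (((n.-1 + n.+1 * (L - 2)) * n.+1).+1 <= 4 * n ^ 2 * L.+1)%N.
  apply: (@leq_trans (n.+1 * n.+1 * L.+1)); last first.
    by rewrite leq_mul2r; apply/orP; right; rewrite -mulnn; nia.
  set a := (n.-1 + _)%N; apply: (@leq_trans ((a + 1) * n.+1)).
    by rewrite mulnDl mul1n; lia.
  rewrite mulnC -mulnA leq_mul2l /a.
  have -> : L.+1 = (L - 2 + 3)%N by lia.
  by rewrite mulnDr; lia.
(* With w = n^3 (L + 1) the left side is at most 1 + 8 w, and w >= 24 makes this at most w^2. *)
have N3 : (8 <= n ^ 3)%N by rewrite (@leq_trans (2 ^ 3)%N) // leq_exp2r //; lia.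
have -> : (n ^ 6 * L.+1 ^ 2 = (n ^ 3 * L.+1) * (n ^ 3 * L.+1))%N.
  by rewrite mulnACA -expnD mulnn.
have h2 : (24 <= n ^ 3 * L.+1)%N by rewrite (leq_mul N3 (_ : 3 <= L.+1)%N).
apply: (@leq_trans (1 + 8 * (n ^ 3 * L.+1))).
  rewrite leq_add2l; apply: leq_trans (leq_mul (leqnn _) h1) _.
  by rewrite (expnS n 2); move: (n ^ 2)%N => p; nia.
by move: (n ^ 3 * L.+1)%N h2 => w h2; nia.
Qed.

(** * The algorithm on matrices *)

Lemma mem_cart (A : eqType) (l : seq A) (s : seq rat) (w : seq A) :
  (w \in cart [seq l | _ <- s]) = (size w == size s) && all (mem l) w.
Proof.
elim: s w => [|r s IH] [|a w] //=; rewrite -/(cart _).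
  by apply/allpairsP => -[[p q] /= []].
apply/allpairsP/idP => [[[p q] /= [pl qs [-> ->]]]|].
  by move: qs; rewrite IH eqSS pl.
rewrite eqSS => /and3P[ws al wl]; exists (a, w); split=> //=.
by rewrite IH ws wl.
Qed.

Lemma uniq_cart (A : eqType) (l : seq A) (s : seq rat) :
  uniq l -> uniq (cart [seq l | _ <- s]).
Proof.
move=> ul; elim: s => //= r s IH; rewrite -/(cart _).
by apply: allpairs_uniq => // -[a w] [a' w'] _ _ /= [-> ->].
Qed.

Lemma big_tag_n (R : Type) (z : R) (op : R -> R -> R) A (a0 : A) n (l : seq A) F :
  size l = n -> \big[op/z]_(p <- tag l) F p =
  \big[op/z]_(i < n) F (i%:R, nth a0 l i).
Proof. by move=> <-; exact: big_tag. Qed.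

Definition ordL A n (F : 'I_n -> A) : seq A := [seq F i | i <- enum 'I_n].

Lemma size_ordL A n (F : 'I_n -> A) : size (ordL F) = n.
Proof. by rewrite size_map size_enum_ord. Qed.

Lemma nth_ordL A n (F : 'I_n -> A) a0 (i : 'I_n) : nth a0 (ordL F) i = F i.
Proof. by rewrite (nth_map i) ?size_enum_ord ?nth_ord_enum. Qed.

Lemma tag_ordL A n (F : 'I_n -> A) : tag (ordL F) = ordL (fun i => (i%:R, F i)).
Proof.
rewrite tagE size_ordL -val_enum_ord -map_comp /ordL.
by elim: (enum 'I_n) => //= i s ->.
Qed.

Lemma ordLE A n (l : seq A) a0 : size l = n ->
  l = ordL (fun i : 'I_n => nth a0 l i).
Proof.
move=> ln; apply: (@eq_from_nth _ a0) => [|i il]; first by rewrite size_ordL.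
by rewrite ln in il; rewrite (nth_ordL _ _ (Ordinal il)).
Qed.

Lemma map_ordL A B n (h : A -> B) (F : 'I_n -> A) :
  map h (ordL F) = ordL (fun i => h (F i)).
Proof. by rewrite /ordL -map_comp. Qed.

Lemma eq_ordL A n (F F' : 'I_n -> A) : F =1 F' -> ordL F = ordL F'.
Proof. by move=> /eq_map; exact. Qed.

(** Multilinearity in the columns: column i of V N^T combines the columns of V with the coefficients
    N i k. All functions f occur, not only the permutations. *)
Lemma det_vandermonde_mul n (V N : 'M[rat]_n) :
  \det (V *m N^T) = \sum_(f : {ffun 'I_n -> 'I_n})
    \det (\matrix_(i, j) V i (f j)) * \prod_i N i (f i).
Proof.
rewrite -det_tr /determinant.
under eq_bigr => s _.
  under eq_bigr => i _ do rewrite mxE mxE.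
  rewrite (bigA_distr_bigA (fun i k => V (s i) k * N^T k i)) /= big_distrr /=.
  over.
rewrite exchange_big /=; apply: eq_bigr => f _.
rewrite -/(determinant _) -det_tr /determinant mulr_suml.
apply: eq_bigr => s _; rewrite -mulrA -big_split /=; congr (_ * _).
by apply: eq_bigr => i _; rewrite !mxE.
Qed.

Definition vdm n : rat := \det (Vandermonde n (\row_(j < n) j%:R) : 'M[rat]_n).

Lemma vdm_neq0 n : vdm n != 0.
Proof.
rewrite /vdm det_Vandermonde; apply/prodf_neq0 => i _; apply/prodf_neq0 => j ij.
by rewrite !mxE subr_eq0 eqr_nat gtn_eqF.
Qed.

(** Take for V the Vandermonde matrix of 0, ..., n - 1. Its columns chosen by f form the Vandermonde
    matrix of the values of f, whose determinant is the product of differences in [delta]. *)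
Lemma delta_det n (s0 : seq rat) (N : 'M[rat]_n) : size s0 = n ->
  delta (cart [seq idx s0 | _ <- s0]) (ordL (fun i => ordL (N i))) =
  vdm n * \det N.
Proof.
move=> sn; rewrite /vdm -[\det N]det_tr -det_mulmx det_vandermonde_mul /delta.
pose g (f : {ffun 'I_n -> 'I_n}) := ordL (fun i => (f i)%:R : rat).
have gi : injective g.
  move=> f f' E; apply/ffunP => i; apply/val_inj/eqP.
  have := congr1 (fun l => nth 0 l i) E.
  by rewrite !nth_ordL => /eqP; rewrite eqr_nat.
(* The words of n indices are listed without repetition and correspond to the functions f. *)
rewrite (perm_big [seq g f | f <- enum {ffun 'I_n -> 'I_n}]) /=; last first.
  apply: uniq_perm.
  - rewrite uniq_cart // idxE map_inj_uniq ?iota_uniq // => i j /eqP.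
    by rewrite eqr_nat => /eqP.
  - by rewrite map_inj_uniq ?enum_uniq.
  move=> w; rewrite mem_cart sn idxE sn; apply/idP/mapP => [|[f _ ->]].
    case/andP=> /eqP wn /allP wl.
    have wk (i : 'I_n) : exists k : 'I_n, nth 0 w i = k%:R.
      have /mapP[k] : nth 0 w i \in [seq i%:R | i <- iota 0 n].
        by apply: wl; rewrite mem_nth ?wn.
      by rewrite mem_iota /= => kn ->; exists (Ordinal kn).
    have [f fE] := fin_all_exists wk.
    exists [ffun i => f i]; rewrite ?mem_enum // /g (ordLE 0 wn).
    by apply: eq_ordL => i; rewrite ffunE.
  rewrite size_ordL eqxx /=; apply/allP => r /mapP[i _ ->].
  by apply/mapP; exists (f i : nat); rewrite ?mem_iota ?add0n ?ltn_ord.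
rewrite big_map big_enum /=; apply: eq_bigr => f _.
rewrite (big_tag_n _ _ 0 _ (size_ordL _)) (big_tag_n _ _ [::] _ (size_ordL _)) /=.
congr (_ * _); last first.
  by apply: eq_bigr => i _; rewrite !nthrE !nth_ordL nthrE nth_ordL.
transitivity (\det (Vandermonde n (\row_(j < n) (f j)%:R) : 'M[rat]_n)).
  rewrite det_Vandermonde; apply: eq_bigr => i _.
  rewrite (big_tag_n _ _ 0 _ (size_ordL _)) /= [RHS]big_mkcond /=.
  apply: eq_bigr => j _; rewrite ler_nat leqNgt !nth_ordL !mxE.
  by case: ltnP.
by congr (\det _); apply/matrixP => i j; rewrite !mxE.
Qed.

Definition rowL n (v : 'rV[rat]_n) : seq rat := ordL (fun j => v 0 j).

Definition toRow n (l : seq rat) : 'rV[rat]_n := \row_j l`_j.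

Lemma rowLK n : cancel (@rowL n) (toRow n).
Proof. by move=> v; apply/rowP => j; rewrite mxE nth_ordL. Qed.

Lemma big_ordL (R : Type) (z : R) (op : Monoid.com_law z) A n (F : 'I_n -> A) H :
  \big[op/z]_(a <- ordL F) H a = \big[op/z]_(i < n) H (F i).
Proof. by rewrite big_map big_enum. Qed.

Lemma big_rowL (R : Type) (z : R) (op : Monoid.com_law z) n (v : 'rV[rat]_n) F :
  \big[op/z]_(a <- rowL v) F a = \big[op/z]_(j < n) F (v 0 j).
Proof. exact: big_ordL. Qed.

Definition raw m n (A : 'M[rat]_(m, n)) (b : 'cV[rat]_m) : input :=
  ((m%:R, n%:R), (ordL (fun i => rowL (row i A)), rowL b^T)).

Lemma enc_rowL n (v : 'rV[rat]_n) : enc (rowL v) = enc_row v.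
Proof. by rewrite /enc_row /= /rowL /ordL -map_comp. Qed.

Lemma enc_raw m n (A : 'M[rat]_(m, n)) b : enc (raw A b) = enc_input A b.
Proof.
rewrite /enc_input -enc_rowL /=; congr (VPair _ (VPair (enc_seq _) _)).
by rewrite map_ordL; apply: eq_ordL => i; exact: (enc_rowL (row i A)).
Qed.

Lemma maxs_ge (l : seq rat) a : a \in l -> a <= maxs l.
Proof.
elim: l => //= c l IH; rewrite inE -/(maxs l) => /predU1P[->|/IH al].
  by case: (lerP c (maxs l)).
by case: (lerP c (maxs l)) => // /ltW; exact: le_trans.
Qed.

Lemma maxs_le (l : seq rat) c : 0 <= c -> (forall a, a \in l -> a <= c) ->
  maxs l <= c.
Proof.
move=> c0; elim: l => //= a l IH H; case: ifP => _; last first.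
  by apply: H; exact: mem_head.
by apply: IH => d dl; apply: H; rewrite inE dl orbT.
Qed.

Lemma maxs_ge0 (l : seq rat) : 0 <= maxs l.
Proof. elim: l => //= c l IH; rewrite -/(maxs l).
by case: (lerP c (maxs l)) => // /ltW; exact: le_trans. Qed.

Section Raw.
Variables (m n : nat) (A : 'M[rat]_(m, n)) (b : 'cV[rat]_m).
Hypotheses (m0 : (0 < m)%N) (n0 : (0 < n)%N).
Local Notation x := (raw A b).
Local Notation L := (enclen_sys_max A b).

Lemma size_row0 : size (row0 x) = n.
Proof.
rewrite /row0 /= -nth0.
by rewrite (nth_ordL _ _ (Ordinal m0)) size_ordL.
Qed.

Lemma prowE : prow x = ordL (fun i => (rowL (row i A), b i 0)).
Proof.
rewrite /prow /= tag_ordL map_ordL; apply: eq_ordL => i /=.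
by rewrite nthrE nth_ordL mxE.
Qed.

Lemma qdenE i : qden (rowL (row i A), b i 0) = qd A b i.
Proof.
by rewrite /qden /= big_rowL; congr (_ * _); apply: eq_bigr => j _; rewrite mxE.
Qed.

Lemma bigM_entries a :
  a \in flatten [seq [seq qden p * `|a| | a : rat <- p.2 :: p.1]
                | p : seq rat * rat <- prow x] ->
  exists i, a = qd A b i * `|b i 0| \/ exists j, a = qd A b i * `|A i j|.
Proof.
rewrite prowE map_ordL => /flatten_mapP[i _]; rewrite /= inE qdenE.
case/predU1P => [->|]; first by exists i; left.
by rewrite map_ordL => /mapP[j _ ->]; exists i; right; exists j; rewrite mxE.
Qed.

Lemma bigM_b i : qd A b i * `|b i 0| <= bigM x.
Proof.
apply: maxs_ge; rewrite prowE map_ordL; apply/flatten_mapP; exists i.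
  exact: mem_enum.
by rewrite /= qdenE mem_head.
Qed.

Lemma bigM_A i j : qd A b i * `|A i j| <= bigM x.
Proof.
apply: maxs_ge; rewrite prowE map_ordL; apply/flatten_mapP; exists i.
  exact: mem_enum.
rewrite /= qdenE inE; apply/orP; right; rewrite map_ordL; apply/mapP.
by exists j; rewrite ?mem_enum // mxE.
Qed.

Lemma bigM_ge0 : 0 <= bigM x. Proof. exact: maxs_ge0. Qed.

Lemma bigM_le : bigM x + 1 <= (2 ^+ (L - 2)) ^+ n.+1.
Proof.
rewrite -lerBrDr; apply: maxs_le => [|a /bigM_entries[i [->|[j ->]]]].
- by rewrite subr_ge0 !exprn_ege1.
- by rewrite lerBrDr qdb_le.
- by rewrite lerBrDr qdA_le.
Qed.

Lemma bndE : bnd x = (n%:R * (bigM x + 1)) ^+ n.+1.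
Proof. by rewrite /bnd big_const_seq count_predT iter_mulr_1 /= size_row0. Qed.

Lemma bnd_le : bnd x <= 2 ^+ ((n.-1 + n.+1 * (L - 2)) * n.+1).
Proof.
rewrite bndE exprM; have M0 := bigM_ge0.
have u0 : 0 <= n%:R * (bigM x + 1) by rewrite mulr_ge0 ?addr_ge0.
rewrite lerXn2r ?nnegrE ?exprn_ge0 // exprD mulnC exprM.
apply: ler_pM; rewrite ?addr_ge0 ?bigM_le //.
(* The bound n <= 2^(n - 1) is an equality for n = 1, where no constant can be lost. *)
rewrite -natrX ler_nat -[X in (X <= _)%N](prednK n0).
by have := ltn_expl n.-1 (ltnSn 1); lia.
Qed.

Lemma size_letters :
  size (letters x) = (m * (1 + (n + n) * size (pows (bnd x))))%N.
Proof.
have H B D (F : B -> seq D) (l : seq B) c :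
    (forall a, size (F a) = c) -> size (flatten (map F l)) = (size l * c)%N.
  by move=> Fc; elim: l => //= a l IH; rewrite size_cat IH Fc mulSn.
rewrite /letters (H _ _ _ _ (1 + (n + n) * size (pows (bnd x)))%N).
  by rewrite prowE size_ordL.
move=> p /=; rewrite (H _ _ _ _ (n + n)%N) => [|e]; first by rewrite mulnC.
by rewrite size_map idxE size_map size_iota size_cat size_row0.
Qed.

Lemma size_letters_le : (2 <= L)%N ->
  (size (letters x) <= m * (n ^ 6 * L.+1 ^ 2))%N.
Proof.
move=> L2; rewrite size_letters leq_mul2l; apply/orP; right.
apply: leq_trans (letter_count n0 L2); rewrite leq_add2l leq_mul2l.
by apply/orP; right; apply: size_pows bnd_le.
Qed.

Lemma L_ge2 : (2 <= L)%N.
Proof.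
exact: leq_trans (enclen_ge2 _) (enclen_sys_maxA A b (Ordinal m0) (Ordinal n0)).
Qed.

Lemma letters_tight i : (rowL (row i A), (b i 0, b i 0)) \in letters x.
Proof.
rewrite /letters prowE map_ordL; apply/flatten_mapP; exists i.
  exact: mem_enum.
by rewrite /= mem_head.
Qed.

Lemma letters_slack i e k : e \in pows (bnd x) -> (k < n + n)%N ->
  (rowL (row i A),
    (b i 0 - e / qd A b i * (1 + (k%:R + 1) / (2 * n%:R)),
     b i 0 - e / qd A b i * (1 + k%:R / (2 * n%:R)))) \in letters x.
Proof.
move=> eB kn; rewrite /letters prowE map_ordL; apply/flatten_mapP; exists i.
  exact: mem_enum.
rewrite /= inE qdenE; apply/orP; right; apply/flatten_mapP; exists e => //.
apply/mapP; exists k%:R => //; rewrite idxE.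
by apply/mapP; exists k; rewrite // mem_iota size_cat size_row0.
Qed.

Lemma lettersP (l : letter) : l \in letters x -> exists i,
  l.1 = rowL (row i A) /\ (l.2 = (b i 0, b i 0) \/ exists e k,
    [/\ e \in pows (bnd x), (k < n + n)%N &
      l.2 = (b i 0 - e / qd A b i * (1 + (k%:R + 1) / (2 * n%:R)),
             b i 0 - e / qd A b i * (1 + k%:R / (2 * n%:R)))]).
Proof.
rewrite /letters prowE map_ordL => /flatten_mapP[i _]; rewrite /= inE.
case/predU1P=> [->|]; first by exists i; split=> //; left.
case/flatten_mapP=> e eB /mapP[s]; rewrite idxE => /mapP[k kn ->] ->.
exists i; split=> //; right; exists e, k; rewrite qdenE; split=> //.
by move: kn; rewrite mem_iota size_cat size_row0.
Qed.

Lemma letters_le (l : letter) : l \in letters x -> l.2.1 <= l.2.2.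
Proof.
case/lettersP=> i [_ [->//|[e [k [eB kn ->]]]]] /=.
have e0 : 0 <= e by case/mapP: eB => j _ ->; rewrite ler0n.
rewrite lerD2l lerN2 ler_wpM2l ?divr_ge0 // ?(ltW (qd_gt0 _ _ _)) //.
by rewrite lerD2l ler_wpM2r ?invr_ge0 ?mulr_ge0 // lerDl.
Qed.

Definition word_of (f : 'I_n -> 'I_m) (l u : 'I_n -> rat) : seq letter :=
  ordL (fun j => (rowL (row (f j) A), (l j, u j))).

Lemma candidatesP w : w \in candidates x -> exists (f : {ffun 'I_n -> 'I_m}) l u,
  w = word_of f l u /\
  forall j, (rowL (row (f j) A), (l j, u j)) \in letters x.
Proof.
rewrite mem_cart size_row0 => /andP[/eqP wn /allP wl].
pose d : letter := ([::], (0, 0)).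
have wk (j : 'I_n) : exists i : 'I_m, (nth d w j).1 = rowL (row i A).
  have /wl/lettersP[i [E _]] : nth d w j \in w by rewrite mem_nth ?wn.
  by exists i.
have [f fE] := fin_all_exists wk.
exists [ffun j => f j], (fun j => (nth d w j).2.1), (fun j => (nth d w j).2.2).
have E j : (rowL (row ([ffun j => f j] j) A), ((nth d w j).2.1, (nth d w j).2.2))
    = nth d w j by rewrite ffunE -fE -!surjective_pairing.
split; first by rewrite [LHS](ordLE d wn); apply: eq_ordL => j; rewrite E.
by move=> j; rewrite E; apply: wl; rewrite mem_nth ?wn.
Qed.

Lemma candidates_word f l u :
  (forall j, (rowL (row (f j) A), (l j, u j)) \in letters x) ->
  word_of f l u \in candidates x.
Proof.
move=> H; rewrite mem_cart size_row0 size_ordL eqxx; apply/allP => w.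
by case/mapP => j _ ->; exact: H.
Qed.

Lemma delta_rowsub (f : 'I_n -> 'I_m) :
  delta (signs x) (ordL (fun j => rowL (row (f j) A))) =
  vdm n * \det (rowsub f A).
Proof.
rewrite -(delta_det _ size_row0); congr delta; apply: eq_ordL => j.
by apply: eq_ordL => k; rewrite !mxE.
Qed.

Lemma coef_rowsub (f : {ffun 'I_n -> 'I_m}) (j : 'I_n) (i : 'I_m) :
  rowsub f A \in unitmx ->
  coef (signs x) (ordL (fun j => rowL (row (f j) A))) j%:R (rowL (row i A)) =
  (A *m invmx (rowsub f A)) i j.
Proof.
move=> uf; rewrite /coef delta_rowsub.
have -> : repl (ordL (fun j => rowL (row (f j) A))) j%:R (rowL (row i A)) =
    ordL (fun k => rowL (row (subst_row f j i k) A)).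
  rewrite /repl tag_ordL map_ordL; apply: eq_ordL => k /=.
  by rewrite ffunE eqr_nat -val_eqE; case: eqP.
rewrite delta_rowsub det_subst_row // mulrCA mulfK //.
by rewrite mulf_neq0 ?vdm_neq0 // -unitfE -unitmxE.
Qed.

Lemma goodE (f : {ffun 'I_n -> 'I_m}) l u :
  good (signs x) (prow x) (word_of f l u) =
  (rowsub f A \in unitmx) && [forall i : 'I_m,
    \sum_j ((A *m invmx (rowsub f A)) i j * ((l j + u j) / 2)
      + `|(A *m invmx (rowsub f A)) i j| * ((u j - l j) * (3 / 2))) <= b i 0].
Proof.
rewrite /good map_ordL /= delta_rowsub mulf_eq0 negb_or vdm_neq0 /=.
rewrite unitmxE unitfE; case: eqP => //= /eqP df.
have uf : rowsub f A \in unitmx by rewrite unitmxE unitfE.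
rewrite prowE tag_ordL; apply/allP/forallP => /= H.
  move=> i; have := H (rowL (row i A), b i 0) (map_f _ (mem_enum _ i)).
  rewrite big_map big_enum /=; congr (_ <= _).
  by apply: eq_bigr => j _; rewrite coef_rowsub.
move=> p /mapP[i _ ->] /=; have := H i; congr (_ <= _).
by rewrite big_map big_enum /=; apply: eq_bigr => j _; rewrite coef_rowsub.
Qed.

End Raw.

(** * Geometry of the cells *)

Section Geometry.
Variables (R : realType) (n : nat).
Implicit Types (S : set 'cV[R]_n) (w : 'rV[rat]_n) (x y : 'cV[R]_n).

Lemma bounded_coordinates S : bounded_set S ->
  exists M, forall x, S x -> forall i, `|x i 0| <= M.
Proof.
case=> M [_ HM]; exists (M + 1) => x Sx i.
have M1 : M < M + 1 by rewrite ltrDl ltr01.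
have /= := HM _ M1 x Sx.
apply: le_trans; rewrite (mx_normrE x : `|x| = _).
exact: (le_bigmax _ (fun ij : 'I_n * 'I_1 => `|x ij.1 ij.2|) (i, 0)).
Qed.

Lemma coordinates_bounded S M : (forall x, S x -> forall i, `|x i 0| <= M) ->
  bounded_set S.
Proof.
move=> SM; exists (Num.max 0 M); split; first exact: num_real.
move=> N; rewrite gt_max => /andP[N0 MN] x Sx /=.
rewrite (mx_normrE x : `|x| = _); apply: bigmax_le; first exact: ltW.
by move=> [i j] _ /=; rewrite ord1; apply: le_trans (SM x Sx i) (ltW MN).
Qed.

Lemma dotrE w x : dotr w x = (map_mx ratr w *m x) 0 0.
Proof. by rewrite mxE; apply: eq_bigr => j _; rewrite mxE. Qed.

Lemma dotrD w x y : dotr w (x + y) = dotr w x + dotr w y.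
Proof. by rewrite !dotrE mulmxDr mxE. Qed.

Lemma dotrN w x : dotr w (- x) = - dotr w x.
Proof. by rewrite !dotrE mulmxN mxE. Qed.

Lemma dotr0 w : dotr w (0 : 'cV[R]_n) = 0.
Proof. by rewrite dotrE mulmx0 mxE. Qed.

Lemma dotrNl w x : dotr (- w) x = - dotr w x.
Proof. by rewrite !dotrE map_mxN mulNmx mxE. Qed.

Lemma dotr_ratr w (v : 'cV[rat]_n) :
  dotr w (map_mx ratr v : 'cV[R]_n) = ratr ((w *m v) 0 0).
Proof.
by rewrite mxE rmorph_sum; apply: eq_bigr => j _; rewrite !mxE rmorphM.
Qed.

Lemma polyhedronE m (A : 'M[rat]_(m, n)) b x :
  polyhedron R A b x <-> forall i, dotr (row i A) x <= ratr (b i 0).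
Proof.
split=> H i; have := H i; rewrite !mxE; congr (_ <= _);
  by apply: eq_bigr => j _; rewrite !mxE.
Qed.

Lemma two_sidedP (W : seq ('rV[rat]_n * rat * rat)) x :
  solset (two_sided_system [::] W) x <->
  forall q, q \in W -> ratr q.1.2 <= dotr q.1.1 x <= ratr q.2.
Proof.
split=> [H q qW|H c].
  have mem c : c \in [:: (- q.1.1, CLe, - q.1.2); (q.1.1, CLe, q.2)] ->
      constr_holds c x.
    by move=> cq; apply: H; apply/flatten_mapP; exists q.
  have := mem _ (mem_head _ _); rewrite /= dotrNl rmorphN lerN2 => ->.
  by apply: (mem (q.1.1, CLe, q.2)); rewrite !inE eqxx orbT.
case/flatten_mapP => q /H/andP[h1 h2]; rewrite !inE => /orP[] /eqP -> //=.
by rewrite dotrNl rmorphN lerN2.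
Qed.

Lemma bounded_ray m (A : 'M[rat]_(m, n)) b (x : 'cV[R]_n) (v : 'cV[rat]_n) :
  bounded_set (polyhedron R A b) -> polyhedron R A b x ->
  (forall i, (A *m v) i 0 <= 0) -> v = 0.
Proof.
move=> /bounded_coordinates[M PM] /polyhedronE Px Av.
apply/colP => k; rewrite [RHS]mxE; apply/eqP; apply: contraT => vk.
(* Chosen so that the step changes coordinate [k] by M + |x_k| + 1, which leads out of the bound
   M. *)
pose t : R := (M + `|x k 0| + 1) / `|ratr (v k 0)|.
have vk0 : 0 < `|ratr (v k 0) : R| by rewrite normr_gt0 fmorph_eq0.
have M0 : 0 <= M by apply: le_trans (PM x _ k) => //; apply/polyhedronE.
have t0 : 0 <= t by apply: divr_ge0 => //; rewrite !addr_ge0.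
have E : `|t * ratr (v k 0)| = M + `|x k 0| + 1.
  by rewrite normrM ger0_norm // divfK ?gt_eqF.
have H : ~ (`|x k 0 + t * ratr (v k 0)| <= M).
  have := lerB_normD (t * ratr (v k 0)) (x k 0).
  by rewrite E [t * _ + _]addrC => h1 h2; lra.
suff Pxt : polyhedron R A b (x + t *: map_mx ratr v).
  by have := PM _ Pxt k; rewrite !mxE => /H.
apply/polyhedronE => i.
rewrite dotrD [dotr _ (t *: _)]dotrE -scalemxAr mxE -dotrE dotr_ratr.
rewrite -row_mul [(row _ _) _ _]mxE.
have := Px i; have : t * ratr ((A *m v) i 0) <= 0.
  by rewrite mulr_ge0_le0 // lerq0.
by lra.
Qed.

(** A kernel vector of A satisfies A v <= 0, so it vanishes. *)
Lemma ray_row_full m (A : 'M[rat]_(m, n)) :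
  (forall v : 'cV[rat]_n, (forall i, (A *m v) i 0 <= 0) -> v = 0) ->
  row_full A.
Proof.
move=> ray; apply: contraT => rA.
have : cokermx A != 0.
  rewrite -mxrank_eq0 mxrank_coker subn_eq0 -ltnNge ltn_neqAle.
  by rewrite rank_leq_col andbT.
case/matrix0Pn => i [j ij].
have c0 : col j (cokermx A) = 0.
  by apply: ray => k; rewrite colE mulmxA mulmx_coker mul0mx mxE.
have := congr1 (fun u : 'cV_n => u i 0) c0; rewrite mxE [in RHS]mxE => E.
by rewrite E eqxx in ij.
Qed.

Section Cell.
Variables (m : nat) (A : 'M[rat]_(m, n)) (b : 'cV[rat]_m).
Variables (f : 'I_n -> 'I_m) (l u : 'I_n -> rat).
Hypotheses (uf : rowsub f A \in unitmx) (lu : forall j, l j <= u j).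
Let c := A *m invmx (rowsub f A).
Hypothesis box : forall i, \sum_j (c i j * ((l j + u j) / 2)
  + `|c i j| * ((u j - l j) * (3 / 2))) <= b i 0.

Definition cell_rows := ordL (fun j => (row (f j) A, l j, u j)).
Definition disp_rows := ordL (fun j => (row (f j) A, - (u j - l j), u j - l j)).

Lemma cell_rowsP x : solset (two_sided_system [::] cell_rows) x <->
  forall j, ratr (l j) <= dotr (row (f j) A) x <= ratr (u j).
Proof.
rewrite two_sidedP; split=> H => [j|q /mapP[j _ ->]]; last exact: H.
by apply: (H (row (f j) A, l j, u j)); apply/mapP; exists j; rewrite ?mem_enum.
Qed.

Lemma disp_rowsP x : solset (two_sided_system [::] disp_rows) x <->
  forall j, `|dotr (row (f j) A) x| <= ratr (u j - l j).
Proof.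
rewrite two_sidedP; split=> H => [j|q /mapP[j _ -> /=]].
  rewrite ler_norml -rmorphN.
  apply: (H (row (f j) A, - (u j - l j), u j - l j)).
  by apply/mapP; exists j; rewrite ?mem_enum.
by rewrite (rmorphN _ (u j - l j)) -ler_norml.
Qed.

Lemma dotr_basis i x : dotr (row i A) x =
  \sum_j ratr (c i j) * dotr (row (f j) A) x.
Proof.
have -> : row i A = row i c *m rowsub f A by rewrite -row_mul mulmxKV.
rewrite dotrE map_mxM -mulmxA mxE; apply: eq_bigr => j _.
rewrite !mxE; congr (_ * _); rewrite /dotr; apply: eq_bigr => k _.
by rewrite !mxE.
Qed.

Lemma box_sub x :
  (forall j, ratr (l j - (u j - l j)) <= dotr (row (f j) A) x
    <= ratr (u j + (u j - l j))) -> polyhedron R A b x.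
Proof.
move=> H; apply/polyhedronE => i; rewrite dotr_basis.
apply: (@le_trans _ _ (ratr (\sum_j (c i j * ((l j + u j) / 2)
  + `|c i j| * ((u j - l j) * (3 / 2)))))); last by rewrite ler_rat.
rewrite rmorph_sum; apply: ler_sum => j _; have := H j.
set t := dotr _ _ => /andP[h1 h2].
rewrite !(rmorphB, rmorphD) /= in h1 h2.
rewrite rmorphD !rmorphM /= ratr_norm !(rmorphB, rmorphD) /=.
set L := ratr (l j) in h1 h2 *; set U := ratr (u j) in h1 h2 *.
set C := ratr (c i j).
rewrite !fmorphV !rmorph_nat.
(* The value [t] is within 3/2 widths of the center of its interval. *)
rewrite -lerBlDl -mulrBr; apply: le_trans (ler_norm _) _; rewrite normrM.
apply: ler_wpM2l => //; rewrite ler_norml; lra.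
Qed.

Lemma cell_sub x : solset (two_sided_system [::] cell_rows) x ->
  polyhedron R A b x.
Proof.
move/cell_rowsP => H; apply: box_sub => j; have /andP[h1 h2] := H j.
have h3 : ratr (l j) <= ratr (u j) :> R by rewrite ler_rat.
by rewrite !(rmorphB, rmorphD) /=; lra.
Qed.

Lemma cell_disp x d : solset (two_sided_system [::] cell_rows) x ->
  solset (two_sided_system [::] disp_rows) d -> polyhedron R A b (x + d).
Proof.
move=> /cell_rowsP H /disp_rowsP K; apply: box_sub => j.
have /andP[h1 h2] := H j; have := K j; rewrite ler_norml => /andP[h3 h4].
by rewrite dotrD !(rmorphB, rmorphD) /= in h3 h4 *; lra.
Qed.

Lemma disp_opp (d : 'cV[R]_n) : solset (two_sided_system [::] disp_rows) d ->
  solset (two_sided_system [::] disp_rows) (- d).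
Proof.
by move=> /disp_rowsP K; apply/disp_rowsP => j; rewrite dotrN normrN.
Qed.

Lemma disp0 : solset (two_sided_system [::] disp_rows) (0 : 'cV[R]_n).
Proof.
apply/disp_rowsP => j; rewrite dotr0 normr0 rmorphB /=.
have h3 : ratr (l j) <= ratr (u j) :> R by rewrite ler_rat.
by lra.
Qed.

Lemma cell_diff x y : solset (two_sided_system [::] cell_rows) x ->
  solset (two_sided_system [::] cell_rows) y ->
  solset (two_sided_system [::] disp_rows) (x - y).
Proof.
move=> /cell_rowsP H /cell_rowsP K; apply/disp_rowsP => j.
have /andP[h1 h2] := H j; have /andP[h3 h4] := K j.
by rewrite dotrD dotrN ler_norml rmorphB /=; lra.
Qed.

(** A point is determined linearly by the values of the basis rows; both the boundedness of D and
    the trivial kernel come from this. *)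
Lemma dotr_inv x k : x k 0 =
  \sum_j ratr (invmx (rowsub f A) k j) * dotr (row (f j) A) x.
Proof.
have -> : x = map_mx ratr (invmx (rowsub f A)) *m (map_mx ratr (rowsub f A) *m x).
  by rewrite mulmxA -map_mxM mulVmx // map_mx1 mul1mx.
rewrite [LHS]mxE; apply: eq_bigr => j _; rewrite !mxE; congr (_ * _).
rewrite mulmxA -map_mxM mulVmx // map_mx1 mul1mx.
by rewrite /dotr; apply: eq_bigr => i _; rewrite !mxE.
Qed.

Lemma disp_bounded : bounded_set
  (solset (two_sided_system [::] disp_rows) : set 'cV[R]_n).
Proof.
(* One bound must serve all coordinates, so the bounds for the individual ones are added. *)
apply: (@coordinates_bounded _ (\sum_k \sum_j
  `|ratr (invmx (rowsub f A) k j)| * ratr (u j - l j))) => x /disp_rowsP H k.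
have w0 j : 0 <= ratr (u j - l j) :> R by apply: le_trans (H j).
rewrite dotr_inv; apply: le_trans (ler_norm_sum _ _ _) _.
rewrite [leRHS](bigD1 k) //= -[leLHS]addr0; apply: lerD; last first.
  by apply: sumr_ge0 => i _; apply: sumr_ge0 => j _; rewrite mulr_ge0.
by apply: ler_sum => j _; rewrite normrM ler_wpM2l.
Qed.

Lemma disp_kernel : trivial_common_kernel R [::] disp_rows.
Proof.
move=> x _ H; apply/colP => k; rewrite [RHS]mxE dotr_inv big1 // => j _.
rewrite (H (row (f j) A, - (u j - l j), u j - l j)) ?mulr0 //.
by apply/mapP; exists j; rewrite ?mem_enum.
Qed.

End Cell.
End Geometry.

(** * Correctness and size of the cover *)

(** The witness is a dominating basis for the slacks of [v], with letters whose intervals contain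
    the values of its rows at [v]. *)
Lemma good_word m n (A : 'M[rat]_(m, n)) (b : 'cV[rat]_m) (v : 'cV[rat]_n) :
  (0 < m)%N -> (0 < n)%N ->
  (forall v : 'cV[rat]_n, (forall i, (A *m v) i 0 <= 0) -> v = 0) ->
  (forall k, v k 0 \is a Num.int) -> (forall i, (A *m v) i 0 <= b i 0) ->
  exists (f : {ffun 'I_n -> 'I_m}) l u,
    [/\ word_of A f l u \in candidates (raw A b),
        good (signs (raw A b)) (prow (raw A b)) (word_of A f l u)
      & forall j, l j <= (A *m v) (f j) 0 <= u j].
Proof.
move=> m0 n0 ray vint Av; pose s i := b i 0 - (A *m v) i 0.
have s0 i : 0 <= s i by rewrite subr_ge0.
have [f uf cs] := dominating_basis (ray_row_full ray) s0.
pose c := A *m invmx (rowsub f A).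
have n20 : 0 < 2 * n%:R :> rat by rewrite mulr_gt0 ?ltr0n.
have lu j : exists lu : rat * rat,
    [/\ (rowL (row (f j) A), lu) \in letters (raw A b),
        lu.1 <= (A *m v) (f j) 0 <= lu.2
      & (lu.2 - lu.1) * (2 * n%:R) <= s (f j)].
  have [sj|sj] := eqVneq (s (f j)) 0.
    exists (b (f j) 0, b (f j) 0); split; first exact: letters_tight.
      by move/eqP: sj; rewrite subr_eq0 => /eqP <-; rewrite lexx.
    by rewrite subrr mul0r.
  have {}sj : 0 < s (f j) by rewrite lt_def sj s0.
  have qs : qd A b (f j) * s (f j) \is a Num.int.
    rewrite mulrBr rpredB ?qdb_int // mxE mulr_sumr rpred_sum // => k _.
    by rewrite mulrA rpredM ?qdA_int.
  have qB : qd A b (f j) * s (f j) <= bnd (raw A b).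
    rewrite bndE //; apply: slack_bound => //.
      exact: bigM_A.
    exact: bigM_b.
  have [e [k [eB kn es h1 h2]]] := slack_interval n0 (qd_gt0 A b (f j)) sj qs qB.
  exists (b (f j) 0 - e / qd A b (f j) * (1 + (k%:R + 1) / (2 * n%:R)),
          b (f j) 0 - e / qd A b (f j) * (1 + k%:R / (2 * n%:R))); split.
  - exact: letters_slack.
  - by rewrite /= /s in h1 h2 *; apply/andP; split; lra.
  rewrite /= opprB addrC addrA subrK -mulrBr opprD addrACA subrr add0r -mulrBl.
  by rewrite addrAC subrr add0r mul1r divfK ?gt_eqF.
have [g gE] := fin_all_exists lu.
have E j : (rowL (row (f j) A), ((g j).1, (g j).2)) \in letters (raw A b).
  by rewrite -surjective_pairing; case: (gE j).
exists f, (fun j => (g j).1), (fun j => (g j).2); split.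
- exact: candidates_word.
- rewrite goodE // uf /=; apply/forallP => i; rewrite -/c.
  (* Each of the n chosen rows gets an equal share of the slack of row [i], so the test can be
     verified term by term. *)
  have -> : b i 0 = \sum_j (c i j * (A *m v) (f j) 0 + s i / n%:R).
    rewrite big_split /= sumr_const card_ord -[_ *+ n]mulr_natr divfK; last first.
      by rewrite pnatr_eq0 -lt0n.
    have -> : \sum_j c i j * (A *m v) (f j) 0 = (A *m v) i 0.
      rewrite -[A in RHS](mulmxKV uf) -/c -mulmxA mxE; apply: eq_bigr => j _.
      by congr (_ * _); rewrite !mxE; apply: eq_bigr => k _; rewrite !mxE.
    by rewrite /s addrC subrK.
  apply: ler_sum => j _; have [_ /andP[h1 h2] h3] := gE j.
  have := cs i j; rewrite -/c; set d := c i j => h4.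
  set l := (g j).1 in h1 h3 *; set u := (g j).2 in h2 h3 *.
  set t := (A *m v) (f j) 0 in h1 h2 *.
  (* The value [t] is at most half a width away from the center. *)
  have h5 : d * ((l + u) / 2) <= d * t + `|d| * ((u - l) / 2).
    rewrite -lerBlDl -mulrBr; apply: le_trans (ler_norm _) _; rewrite normrM.
    by apply: ler_wpM2l => //; rewrite ler_norml; apply/andP; split; lra.
  have h6 : `|d| * (2 * (u - l)) <= s i / n%:R.
    rewrite ler_pdivlMr ?ltr0n //; apply: le_trans h4.
    have -> : `|d| * (2 * (u - l)) * n%:R = `|d| * ((u - l) * (2 * n%:R)) by ring.
    by rewrite ler_wpM2l.
  apply: le_trans (lerD h5 (lexx _)) _; rewrite -addrA lerD2l.
  by apply: le_trans h6; rewrite -mulrDr ler_wpM2l //; lra.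
- by move=> j; case: (gE j).
Qed.

(** The relation is fixed to [CLe]; by [cellL_shape] the algorithm only outputs the code 1 of this
    relation. *)
Definition to_constr n (t : seq rat * (rat * rat)) : constr n :=
  (toRow n t.1, CLe, t.2.2).

Definition coverM m n (A : 'M[rat]_(m, n)) (b : 'cV[rat]_m) :
    seq (seq (constr n) * seq (constr n)) :=
  [seq (map (to_constr n) CD.1, map (to_constr n) CD.2)
  | CD <- coverL (raw A b)].

Section Cover.
Variables (m n : nat) (A : 'M[rat]_(m, n)) (b : 'cV[rat]_m).
Hypotheses (m0 : (0 < m)%N) (n0 : (0 < n)%N).
Local Notation x := (raw A b).
Local Notation L := (enclen_sys_max A b).

Lemma to_constr_cellL (f : 'I_n -> 'I_m) l u :
  map (to_constr n) (cellL (word_of A f l u)) =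
  two_sided_system [::] (cell_rows A f l u).
Proof.
rewrite /cellL map_ordL map_flatten map_ordL /two_sided_system map_ordL /=.
congr flatten; apply: eq_ordL => j.
rewrite /to_constr /= rowLK; congr [:: (_, _, _); _].
apply/rowP => k; rewrite !mxE (nth_map 0) ?size_ordL // nth_ordL.
by rewrite mxE.
Qed.

Lemma dispLE (f : 'I_n -> 'I_m) l u : dispL (word_of A f l u) =
  cellL (word_of A f (fun j => - (u j - l j)) (fun j => u j - l j)).
Proof. by rewrite /dispL map_ordL. Qed.

Lemma mem_coverL CD : CD \in coverL x -> exists (f : {ffun 'I_n -> 'I_m}) l u,
  [/\ good (signs x) (prow x) (word_of A f l u),
      forall j, (rowL (row (f j) A), (l j, u j)) \in letters x,
      CD.1 = cellL (word_of A f l u)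
    & CD.2 = dispL (word_of A f l u)].
Proof.
case/flatten_mapP => w /(candidatesP m0)[f [l [u [-> H]]]].
case: ifP => // gw; rewrite inE => /eqP ->.
by exists f, l, u.
Qed.

Lemma mem_coverM CD : CD \in coverM A b -> exists (f : {ffun 'I_n -> 'I_m}) l u,
  [/\ good (signs x) (prow x) (word_of A f l u),
      forall j, (rowL (row (f j) A), (l j, u j)) \in letters x,
      CD.1 = two_sided_system [::] (cell_rows A f l u)
    & CD.2 = two_sided_system [::] (disp_rows A f l u)].
Proof.
case/mapP => CD' /mem_coverL[f [l [u [gw lu E1 E2]]]] ->.
exists f, l, u; split=> //=; first by rewrite E1 to_constr_cellL.
by rewrite E2 dispLE to_constr_cellL.
Qed.

Lemma enc_descr_to_constr (s : seq (seq rat * (rat * rat))) :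
  (forall t, t \in s -> size t.1 = n /\ t.2.1 = 1) ->
  enc s = enc_descr (map (to_constr n) s).
Proof.
move=> H; rewrite /enc_descr -map_comp [LHS]/=; congr enc_seq.
apply/eq_in_map => -[r [k beta]] /H[/= rn ->].
rewrite /enc_constr /= -enc_rowL; congr (VPair _ _).
have -> : rowL (toRow n r) = r; last by [].
by rewrite [RHS](ordLE 0 rn); apply: eq_ordL => j; rewrite mxE.
Qed.

Lemma cellL_shape (f : 'I_n -> 'I_m) l u t :
  t \in cellL (word_of A f l u) -> size t.1 = n /\ t.2.1 = 1.
Proof.
rewrite /cellL map_ordL => /flatten_mapP[j _]; rewrite !inE.
by case/orP => /eqP -> /=; split=> //; [rewrite size_map|]; exact: size_ordL.
Qed.

Lemma enc_coverM : enc (coverL x) = enc_cover (coverM A b).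
Proof.
rewrite /enc_cover /coverM -map_comp [LHS]/=; congr enc_seq.
apply/eq_in_map => -[C D] /mem_coverL[f [l [u [_ _ /= -> ->]]]] /=.
rewrite -!enc_descr_to_constr // => t; last exact: cellL_shape.
by rewrite dispLE; exact: cellL_shape.
Qed.

Lemma size_coverM :
  (size (coverM A b) <= m.+1 ^ n * n ^ (6 * n) * L.+1 ^ (2 * n))%N.
Proof.
rewrite size_map.
apply: (@leq_trans (size (candidates x))).
  rewrite /coverL; elim: (candidates x) => //= w s IH.
  by rewrite size_cat -add1n leq_add //; case: ifP.
rewrite size_cart big_map big_const_seq count_predT iter_muln_1 size_row0 //.
apply: (@leq_trans ((m * (n ^ 6 * L.+1 ^ 2)) ^ n)).
  by apply: leq_exp2r_w; apply: size_letters_le => //; exact: L_ge2.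
by rewrite (expnMn m) (expnMn (n ^ 6)) -!expnM mulnA !leq_mul // leq_exp2r.
Qed.

Variable R : realType.

Lemma coverM_correct : bounded_set (polyhedron R A b) ->
  symmetric_displacement_cover (polyhedron R A b) (coverM A b).
Proof.
move=> bP; split.
  move=> z Pz; pose v : 'cV[rat]_n := map_mx intr z.
  have zv : map_mx intr z = map_mx ratr v :> 'cV[R]_n.
    by apply/matrixP => i j; rewrite !mxE ratr_int.
  (* Boundedness excludes rays only when P is nonempty; here it contains [z], and without integer
     points there is nothing to cover. *)
  have ray : forall v : 'cV[rat]_n, (forall i, (A *m v) i 0 <= 0) -> v = 0.
    by move=> v'; apply: bounded_ray bP Pz.
  have [|i|f [l [u [wc gw lu]]]] := good_word m0 n0 ray
    (_ : forall k, v k 0 \is a Num.int) (_ : forall i, (A *m v) i 0 <= b i 0).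
  - by move=> k; rewrite /v mxE rpred_int.
  - have /polyhedronE/(_ i) := Pz.
    by rewrite zv dotr_ratr ler_rat -row_mul [(row _ _) _ _]mxE.
  exists (two_sided_system [::] (cell_rows A f l u),
          two_sided_system [::] (disp_rows A f l u)).
    apply/mapP; exists (cellL (word_of A f l u), dispL (word_of A f l u)).
      by apply/flatten_mapP; exists (word_of A f l u); rewrite // gw mem_head.
    by rewrite /= dispLE !to_constr_cellL.
  apply/cell_rowsP => j; have := lu j.
  by rewrite zv dotr_ratr !ler_rat -row_mul [(row _ _) _ _]mxE.
move=> CD /mem_coverM[f [l [u [gw H E1 E2]]]] C D; rewrite {}/C {}/D {}E1 {}E2.
have lu j : l j <= u j by have := letters_le m0 (H j).
move: gw; rewrite goodE // => /andP[uf /forallP box].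
split.
- by move=> y; apply: cell_sub.
- split; [split | exact: disp0 | exact: disp_opp].
    by move=> c /flatten_mapP[q _]; rewrite !inE => /orP[] /eqP ->.
  exact: disp_bounded.
- exact: cell_diff.
- by move=> y d; apply: cell_disp.
- by move=> y d yC dD; apply: cell_disp yC (disp_opp dD).
Qed.

End Cover.

Lemma ht_nat k : ht k%:R = k.+1.
Proof. by rewrite -[k%:R]/(k%:~R) ht_int. Qed.

Section Sizes.
Variables (m n : nat) (A : 'M[rat]_(m, n)) (b : 'cV[rat]_m).
Hypotheses (m0 : (0 < m)%N) (n0 : (0 < n)%N).
Local Notation x := (raw A b).
Local Notation L := (enclen_sys_max A b).

(** Heights multiply along the formula of an endpoint, so exponents add; the dominant one, of order
    n^2 L, comes from the bound [bnd] on the dyadic numbers. *)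
Lemma letters_ht l : l \in letters x ->
  (ht l.2.1 <= 2 ^ (20 * n.+1 ^ 2 * L.+1))%N /\
  (ht l.2.2 <= 2 ^ (20 * n.+1 ^ 2 * L.+1))%N.
Proof.
case/(lettersP m0) => i [_ H].
have hb : (ht (b i 0%R) <= 2 ^ L)%N.
  by apply: leq_trans (ht_enclen _) _; rewrite leq_exp2l // enclen_sys_maxb.
case: H => [->|[e [k [eB kn ->]]]] /=.
  suff h : (L <= 20 * n.+1 ^ 2 * L.+1)%N.
    by split; apply: leq_trans hb _; rewrite leq_exp2l.
  by apply: leq_trans (leqnSn L) _; rewrite leq_pmull // muln_gt0 expn_gt0.
pose J := ((n.-1 + n.+1 * (L - 2)) * n.+1).+1.
have he : (ht e <= 2 ^ J.+1)%N.
  case/mapP: eB => j; rewrite mem_iota add0n => jB ->; rewrite ht_nat.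
  have jJ : (j < J)%N.
    apply: leq_trans jB _; have := size_pows (bnd_le A b m0 n0).
    by rewrite /pows size_map size_iota.
  have : (2 ^ j <= 2 ^ J)%N by rewrite leq_exp2l // ltnW.
  by rewrite expnS; have := expn_gt0 2 J; lia.
have hs s d : (s <= 2 * n)%N -> (d <= 2 * n)%N ->
    (ht (b i 0 - e / qd A b i * (1 + s%:R / d%:R))%R <=
     2 ^ (L + (J.+1 + (L * n.+1).+1 + (1 + ((2 * n).+1 + (2 * n).+1)))))%N.
  move=> sn dn.
  have pn k' : (k' <= 2 * n)%N -> (ht k'%:R <= 2 ^ (2 * n).+1)%N.
    move=> kn'; rewrite ht_nat; apply: leq_ltn_trans kn' _.
    by apply: ltn_trans (ltn_expl _ (ltnSn 1)) _; rewrite ltn_exp2l.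
  apply: leq_trans (htD _ _) _; rewrite expnD leq_mul // htN.
  apply: leq_trans (htM _ _) _; rewrite expnD leq_mul //.
    apply: leq_trans (htM _ _) _; rewrite expnD leq_mul //.
    exact: leq_trans (htV _) (qd_ht A b i).
  apply: leq_trans (htD _ _) _; rewrite expnD leq_mul //.
  apply: leq_trans (htM _ _) _; rewrite expnD leq_mul ?pn //.
  exact: leq_trans (htV _) (pn _ dn).
have dE : 2 * n%:R = (2 * n)%:R :> rat by rewrite natrM.
have JL : (J <= n.+1 ^ 2 * L.+1)%N.
  rewrite /J; set a := (n.-1 + _)%N; apply: (@leq_trans ((a + 1) * n.+1)).
    by rewrite mulnDl mul1n; lia.
  rewrite mulnC -mulnn -mulnA leq_mul2l /a.
  have -> : L.+1 = (L - 2 + 3)%N by have := L_ge2 A b m0 n0; lia.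
  by rewrite mulnDr; lia.
have bound : (L + (J.+1 + (L * n.+1).+1 + (1 + ((2 * n).+1 + (2 * n).+1))) <=
    20 * n.+1 ^ 2 * L.+1)%N.
  by move: JL; rewrite -mulnn -mulnA; move: (L) (J) => L' J' JL; nia.
rewrite -(leq_exp2l _ _ (ltnSn 1)) in bound.
by rewrite dE natr1; split; apply: leq_trans bound; apply: hs; lia.
Qed.

Lemma mx_enclen_row i : (mx_enclen (row i A) <= 3 + (2 * n + 5) + n * L)%N.
Proof.
rewrite /mx_enclen big_ord1; apply: leq_add.
  by apply: leq_add => //; exact: enclen_nat.
rewrite -[X in (_ <= X * _)%N](size_enum_ord n) -big_enum /=.
by apply: leq_sum_split => l1 j l2 _; rewrite mxE enclen_sys_maxA.
Qed.

Lemma mx_enclenN k (w : 'rV[rat]_k) : mx_enclen (- w) = mx_enclen w.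
Proof.
rewrite /mx_enclen; congr (_ + _)%N.
by apply: eq_bigr => i _; apply: eq_bigr => j _; rewrite mxE enclenN.
Qed.

Lemma descr_enclen_cell (f : 'I_n -> 'I_m) l u H :
  (forall j, (enclen (l j) <= H)%N) -> (forall j, (enclen (u j) <= H)%N) ->
  (descr_enclen (two_sided_system [::] (cell_rows A f l u)) <=
   (2 * (n * 2) + 5) + (n * 2) * (3 + (2 * n + 5) + n * L + 3 + H))%N.
Proof.
move=> lH uH; rewrite /descr_enclen /two_sided_system /=.
set s := flatten _; have sn : size s = (n * 2)%N.
  rewrite /s size_flatten /shape -map_comp /cell_rows.
  have -> (F := fun j => (row (f j) A, l j, u j)) (w : seq 'I_n) :
      sumn [seq size [:: (- q.1.1, CLe, - q.1.2); (q.1.1, CLe, q.2)]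
           | q <- [seq F j | j <- w]] = (size w * 2)%N.
    by elim: w => //= j w ->.
  by rewrite size_enum_ord.
rewrite sn; apply: leq_add; first exact: enclen_nat.
rewrite -[X in (_ <= X * _)%N]sn; apply: leq_sum_split => l1 c l2 sE.
have : c \in s by rewrite sE mem_cat mem_head orbT.
have e1 : enclen 1 = 3%N by [].
rewrite /s => /flatten_mapP[q /mapP[j _ ->]]; rewrite !inE /constr_enclen.
case/orP => /eqP -> /=; rewrite ?mx_enclenN ?enclenN e1.
  by apply: leq_add (lH j); rewrite leq_add2r mx_enclen_row.
by apply: leq_add (uH j); rewrite leq_add2r mx_enclen_row.
Qed.

Lemma pair_enclen_coverM CD : CD \in coverM A b ->
  (pair_enclen CD <= 1000 * n.+1 ^ 3 * L.+1)%N.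
Proof.
move=> /(mem_coverM m0)[f [l [u [_ H E1 E2]]]].
set T := (20 * n.+1 ^ 2 * L.+1)%N.
have lT j : (ht (l j) <= 2 ^ T)%N by have [] := letters_ht (H j).
have uT j : (ht (u j) <= 2 ^ T)%N by have [] := letters_ht (H j).
have duT j : (enclen (u j - l j) <= 2 * (T + T) + 3)%N.
  apply: enclen_ht; apply: leq_trans (htD _ _) _.
  by rewrite htN expnD leq_mul.
have c1 : (descr_enclen CD.1 <=
    (2 * (n * 2) + 5) + (n * 2) * (3 + (2 * n + 5) + n * L + 3 + (2 * (T + T) + 3)))%N.
  rewrite E1; apply: descr_enclen_cell => j.
    by apply: leq_trans (enclen_ht (lT j)) _; lia.
  by apply: leq_trans (enclen_ht (uT j)) _; lia.
have c2 : (descr_enclen CD.2 <=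
    (2 * (n * 2) + 5) + (n * 2) * (3 + (2 * n + 5) + n * L + 3 + (2 * (T + T) + 3)))%N.
  rewrite E2; apply: (descr_enclen_cell f
    (l := fun j => - (u j - l j)) (u := fun j => u j - l j)) => j //.
  by rewrite enclenN.
rewrite /pair_enclen; apply: leq_trans (leq_add c1 c2) _.
rewrite (_ : 1000 * n.+1 ^ 3 * L.+1 = 50 * n.+1 * T)%N; last first.
  by rewrite /T (expnS _ 2); lia.
have TN : (20 * n.+1 * L.+1 <= T)%N.
  by rewrite /T -mulnn; move: (L) => L'; nia.
by move: (L) (T) TN => L' T' TN; nia.
Qed.

End Sizes.

Definition size_poly : {poly nat} := 1000%N%:P * ('X + 1) ^+ 3.

Lemma size_polyE n : size_poly.[n] = (1000 * n.+1 ^ 3)%N.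
Proof.
rewrite /size_poly hornerM hornerC horner_exp hornerD hornerX hornerC.
by rewrite -[(n + 1)%R]/(n + 1)%N addn1 -[RHS]/(1000 * n.+1 ^+ 3)%R.
Qed.

(** * Running time *)

(** [PT] speaks of functions on one type, so all dimensions are bundled, restricted to positive
    ones. *)
Record instance := Instance {
  inst_m : nat;
  inst_n : nat;
  inst_A : 'M[rat]_(inst_m, inst_n);
  inst_b : 'cV[rat]_inst_m;
  inst_m_gt0 : (0 < inst_m)%N;
  inst_n_gt0 : (0 < inst_n)%N }.

(** A fixed power of it is the claimed time: the exponents of the first three factors become O(n),
    that of the last one stays absolute. *)
Definition budget (m n : nat) (A : 'M[rat]_(m, n)) (b : 'cV[rat]_m) : nat :=
  (m.+1 ^ n * n ^ n * (enclen_sys_max A b).+1 ^ n * (enclen_sys A b).+1)%N.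

Lemma vsize_instance (x : instance) :
  (vsize (enc_input (inst_A x) (inst_b x)) <=
   budget (inst_A x) (inst_b x) + vsize (enc_input (inst_A x) (inst_b x)))%N.
Proof. exact: leq_addl. Qed.

(* As the measure contains the budget, enumerations of that size count as
   polynomial. *)
#[global] Instance data_instance : data instance := Data vsize_instance.

Definition raw_instance (x : instance) : input := raw (inst_A x) (inst_b x).

Lemma msr_rat (r : rat) : msr r = enclen r.
Proof. by []. Qed.

Lemma msr_seq_vsize A {dA : data A} (s : seq A) :
  (forall a : A, msr a = vsize (enc a)) -> msr s = vsize (enc s).
Proof.
by move=> H; elim: s => // a s IH; rewrite msr_cons IH H /= add1n addSn.
Qed.

Lemma msr_raw (x : input) : msr x = vsize (enc x).
Proof.
case: x => [[p q] [rs r]]; rewrite !msr_pair /=.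
rewrite (msr_seq_vsize r) // (msr_seq_vsize rs) => [|s]; last first.
  exact: msr_seq_vsize.
by rewrite !add1n !addSn.
Qed.

(** An instance is encoded exactly as its lists, so the identity program works and only the measure
    changes. *)
Lemma PT_raw_instance : PT raw_instance.
Proof.
exists [::], (EVar 0), msr; split.
- move=> x; exists (vsize (enc x)); first exact: vsize_enc.
  rewrite enc_raw; exact: (@ev_var [::] [:: enc x] 0).
- exact: polyb_msr.
apply: polyb_le polyb_msr => x.
by rewrite msr_raw enc_raw; exact: vsize_instance.
Qed.

Lemma leq_expn_self n k : (0 < n)%N -> (k <= k ^ n)%N.
Proof.
by case: n => // n _; case: k => // k; rewrite expnS leq_pmulr ?expn_gt0.
Qed.

Section Budget.
Variables (m n : nat) (A : 'M[rat]_(m, n)) (b : 'cV[rat]_m).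
Hypotheses (m0 : (0 < m)%N) (n0 : (0 < n)%N).
Local Notation L := (enclen_sys_max A b).
Local Notation N := (budget A b).

Lemma budget_ge : [/\ (m.+1 ^ n <= N)%N, (n ^ n <= N)%N, (L.+1 ^ n <= N)%N
  & ((enclen_sys A b).+1 <= N)%N].
Proof.
rewrite /budget; set a := (m.+1 ^ n)%N; set c := (n ^ n)%N.
set d := (L.+1 ^ n)%N; set e := (enclen_sys A b).+1.
have [a0 c0 d0] : [/\ (0 < a)%N, (0 < c)%N & (0 < d)%N].
  by rewrite !expn_gt0 n0.
have e0 : (0 < e)%N by [].
split; last by rewrite leq_pmull // !muln_gt0 a0 c0.
- by rewrite -!mulnA leq_pmulr // !muln_gt0 c0 d0.
- by rewrite -!mulnA mulnCA leq_pmulr // !muln_gt0 a0 d0.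
- by rewrite mulnAC leq_pmull // !muln_gt0 a0 c0.
Qed.

(** Squaring the budget thus absorbs a factor 9. For n = 1 the factor n^n is no help; the two threes
    come from L + 1 and S + 1. *)
Lemma budget_ge9 : (9 <= N)%N.
Proof.
have L2 := L_ge2 A b m0 n0.
rewrite /budget (@leq_mul 3 3) //; last first.
  rewrite ltnS /enclen_sys /mx_enclen.
  by have := enclen_ge2 m%:R; lia.
rewrite (@leq_mul 1 3) //; first by rewrite muln_gt0 !expn_gt0 n0.
by apply: leq_trans (leq_expn_self _ n0).
Qed.

Lemma letters_budget : ((size (letters (raw A b))).+1 ^ n <= N ^ 9)%N.
Proof.
have L2 := L_ge2 A b m0 n0.
apply: (@leq_trans ((m.+1 * (n ^ 6 * L.+1 ^ 2)) ^ n)).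
  apply: leq_exp2r_w; rewrite mulSn -add1n; apply: leq_add.
    by rewrite muln_gt0 !expn_gt0 n0.
  exact: size_letters_le.
have [h1 h2 h3 _] := budget_ge.
(* The exponent 9 is 1 + 6 + 2, for the factors m + 1, n^6 and (L + 1)^2. *)
rewrite (expnMn m.+1) (expnMn (n ^ 6)) -!expnM [(6 * n)%N]mulnC [(2 * n)%N]mulnC.
rewrite !expnM -[9%N]/(1 + (6 + 2))%N !expnD expn1.
by apply: leq_mul => //; apply: leq_mul; apply: leq_exp2r_w.
Qed.

Lemma signs_budget : (n.+1 ^ n <= N)%N.
Proof.
apply: (@leq_trans (m.+1 ^ n * n ^ n)).
  by rewrite -expnMn; apply: leq_exp2r_w; nia.
by rewrite /budget -mulnA leq_pmulr // muln_gt0 expn_gt0.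
Qed.

(** The nodes of the lists are paid for by the entries, each of which has length at least 2. *)
Lemma input_budget : (vsize (enc_input A b) <= 7 * N)%N.
Proof.
have [_ _ _ h] := budget_ge.
apply: leq_trans (leq_mul (leqnn 7) h).
rewrite -enc_raw -msr_raw /raw !msr_pair !msr_seqE /= big_ordL big_rowL /=.
rewrite /enclen_sys /mx_enclen.
have hA : (\sum_(i < m) (msr (rowL (row i A))).+1 <=
    \sum_(i < m) 4 * \sum_(j < n) enclen (A i j))%N.
  apply: leq_sum => i _; rewrite msr_seqE big_rowL.
  have h1 : (\sum_(j < n) (msr (row i A 0%R j)).+1 <=
      2 * \sum_(j < n) enclen (A i j))%N.
    rewrite big_distrr /=; apply: leq_sum => j _; rewrite mxE msr_rat.
    by have := enclen_ge2 (A i j); lia.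
  have h2 : (2 <= \sum_(j < n) enclen (A i j))%N.
    rewrite (bigD1 (Ordinal n0)) //=.
    exact: leq_trans (enclen_ge2 _) (leq_addr _ _).
  apply: (@leq_trans (2 + 2 * \sum_(j < n) enclen (A i j)).+1).
    by rewrite ltnS leq_add2l.
  by lia.
have hb : (\sum_(j < m) (msr (b^T 0%R j)).+1 <=
    2 * \sum_(i < m) \sum_(j < 1) enclen (b i j))%N.
  rewrite big_distrr /=; apply: leq_sum => i _; rewrite big_ord1 mxE msr_rat.
  by have := enclen_ge2 (b i ord0); rewrite (_ : ord0 = 0%R) //; lia.
rewrite -big_distrr /= in hA.
set SA := (\sum_(i < m) \sum_j _)%N in hA *.
set Sb := (\sum_(i < m) \sum_j _)%N in hb *.
apply: (@leq_ltn_trans ((enclen m%:R + enclen n%:R).+1 +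
    (2 + 4 * SA + (2 + 2 * Sb)).+1)); last by lia.
by rewrite leq_add2l ltnS; apply: leq_add; rewrite leq_add2l.
Qed.

End Budget.

Lemma PT_cover_instance : PT (fun x : instance => coverL (raw_instance x)).
Proof.
have pN : polyb (fun x : instance => budget (inst_A x) (inst_b x)).
  by apply: polyb_le polyb_msr => x; exact: leq_addr.
apply: PT_coverL; first exact: PT_raw_instance.
- apply: polyb_le (polybX 9 pN) => x.
  rewrite size_row0 ?inst_m_gt0 //.
  exact: (letters_budget _ _ (inst_m_gt0 x) (inst_n_gt0 x)).
- apply: polyb_le pN => x; rewrite size_row0 ?inst_m_gt0 //.
  exact: (signs_budget _ _ (inst_m_gt0 x) (inst_n_gt0 x)).
Qed.

(** Without rows P would be the whole space, and the vector of ones a ray. *)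
Lemma bounded_rows_gt0 (R : realType) m n (A : 'M[rat]_(m, n)) b : (0 < n)%N ->
  bounded_set (polyhedron R A b) -> (0 < m)%N.
Proof.
move=> n0 bP; rewrite lt0n; apply/eqP => mE.
have I0 : 'I_m -> False by case=> k; rewrite mE.
have P0 : polyhedron R A b 0 by move=> i; case: (I0 i).
have /matrixP/(_ (Ordinal n0) 0)/eqP : const_mx 1 = 0 :> 'cV[rat]_n.
  by apply: bounded_ray bP P0 _ => i; case: (I0 i).
by rewrite !mxE oner_eq0.
Qed.

Theorem theorem2p2 (R : realType) :
  exists (alg : program) (c k1 k2 k3 d : nat) (p : {poly nat}),
  forall (m n : nat) (A : 'M[rat]_(m, n)) (b : 'cV[rat]_m),
    (1 <= n)%N ->
    bounded_set (polyhedron R A b) ->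
    let L := enclen_sys_max A b in
    let S := enclen_sys A b in
    exists (cov : seq (seq (constr n) * seq (constr n))) (t : nat),
      [/\ computes_in alg (enc_input A b) (enc_cover cov) t
            /\ (t <= m.+1 ^ (k1 * n) * n ^ (k2 * n) * L.+1 ^ (k3 * n)
                     * S.+1 ^ d)%N,
          symmetric_displacement_cover (polyhedron R A b) cov,
          (size cov <= m.+1 ^ n * n ^ (c * n) * L.+1 ^ (2 * n))%N,
          forall CD, CD \in cov -> (pair_enclen CD <= p.[n] * L.+1)%N
        & forall CD, CD \in cov ->
            exists (E : seq 'rV[rat]_n) (W : seq ('rV[rat]_n * rat * rat)),
              [/\ CD.2 = two_sided_system E W,
                  (size W <= n)%N
                & trivial_common_kernel R E W]].
Proof.
have [ds [e [T [run [k Tk] _]]]] := PT_cover_instance.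
(* The 6 is the exponent of n in [letter_count]. With N the budget, the measure plus 2 is at most 9
   N <= N^2, so the time (measure + 2)^k is at most N^(2 k). *)
exists (Program ds e), 6%N, (2 * k)%N, (2 * k)%N, (2 * k)%N, (2 * k)%N, size_poly.
move=> m n A b n0 bP L S; have m0 := bounded_rows_gt0 n0 bP.
pose x := Instance A b m0 n0; have [t tT ev] := run x.
exists (coverM A b), t; split.
- split; first by rewrite -enc_coverM.
  apply: leq_trans tT (leq_trans (Tk x) _).
  rewrite -(mulnC n) 3!(expnM _ n) -!(expnMn _ _ (2 * k)) -/(budget A b) expnM.
  apply: leq_exp2r_w.
  have := budget_ge9 A b m0 n0; have := input_budget A b m0 n0.
  rewrite -[msr x]/(budget A b + vsize (enc_input A b))%N.
  move: (budget A b) (vsize _) => N w wN N9; rewrite -mulnn.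
  by apply: (@leq_trans (9 * N)%N); [lia | rewrite leq_mul2r N9 orbT].
- exact: coverM_correct.
- exact: size_coverM.
- by move=> CD /(pair_enclen_coverM m0 n0); rewrite size_polyE.
move=> CD /(mem_coverM m0)[f [l [u [gw H E1 E2]]]].
(* The subspace is the whole space, and the n normals are the rows of an invertible matrix. *)
exists [::], (disp_rows A f l u); split=> //; first by rewrite size_ordL.
move: gw; rewrite goodE // => /andP[uf _].
exact: disp_kernel.
Qed.
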